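(* Let $\varphi$ be the unique classical solution, in the class of functions with at most linear growth in $s$, of the problem $$\frac{\partial \varphi}{\partial t}(t,s,i,y)+\frac{\partial \varphi}{\partial y}(t,s,i,y)+r(i)s\frac{\partial \varphi}{\partial s}(t,s,i,y)+\frac12\sigma^2(i)s^2\frac{\partial^2\varphi}{\partial s^2}(t,s,i,y)+\sum_{j\neq i}\lambda_{ij}(y)\big(\varphi(t,s,j,0)-\varphi(t,s,i,y)\big)=r(i)\varphi(t,s,i,y)$$ on $\mathcal{D}$, with $\lim_{s\downarrow 0}\varphi(t,s,i,y)=0$ for all $t\in[0,T]$, $i\in\mathcal{X}$, $y\in[0,t]$, and $\varphi(T,s,i,y)=(s-K)^+$ for all $s>0$, $0\le y\le T$, $i\in\mathcal{X}$. For $(t,s,i,y)\in\mathcal{D}$ set $$\psi(t,s,i,y):=\frac{1-F(T-t+y\mid i)}{1-F(y\mid i)}\frac{\partial\eta_i(t,s)}{\partial s}+\int_0^{T-t}e^{-r(i)v}\frac{f(y+v\mid i)}{1-F(y\mid i)}\sum_{j\ne i}p_{ij}(y+v)\left[\int_0^\infty\varphi(t+v,x,j,0)\,\frac{e^{-\frac12\left(\left(\ln\frac{x}{s}-\left(r(i)-\frac{\sigma^2(i)}{2}\right)v\right)\frac{1}{\sigma(i)\sqrt v}\right)^2}}{\sqrt{2\pi}\,x\,s\,\sigma(i)\sqrt v}\;\frac{\ln\frac{x}{s}-\left(r(i)-\frac{\sigma^2(i)}{2}\right)v}{\sigma(i)^2v}\,dx\right]dv.$$ Then $\psi(t,s,i,y)=\frac{\partial}{\partial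 s}\varphi(t,s,i,y)$ for all $(t,s,i,y)\in\mathcal{D}$.
   Context: Fix $T>0$, $K>0$, a positive integer $k$, $\mathcal{X}=\{1,\dots,k\}$, and functions $r:\mathcal{X}\to[0,\infty)$, $\sigma:\mathcal{X}\to(0,\infty)$. For $i\ne j$ in $\mathcal{X}$ let $\lambda_{ij}:[0,\infty)\to(0,\infty)$, and set $\lambda_{ii}(y):=-\sum_{j\ne i}\lambda_{ij}(y)$, $\Lambda_i(y):=\int_0^y|\lambda_{ii}(v)|\,dv$, $F(y\mid i):=1-e^{-\Lambda_i(y)}$, $f(y\mid i):=\frac{d}{dy}F(y\mid i)$, $p_{ij}(y):=\lambda_{ij}(y)/|\lambda_{ii}(y)|$ for $j\neq i$, $p_{ii}(y):=0$, $\hat p_{ij}:=\int_0^\infty p_{ij}(y)\,dF(y\mid i)$. Standing assumption: (i) each $\lambda_{ij}$ is differentiable; (ii) $\lim_{y\to\infty}\Lambda_i(y)=\infty$ for each $i$; (iii) the matrix $(\hat p_{ij})$ is irreducible. For each $i$, $\eta_i$ is the classical solution with at most linear growth in $s$ of the Black–Scholes–Merton problem $\frac{\partial\eta_i}{\partial t}+r(i)s\frac{\partial\eta_i}{\partial s}+\frac12\sigma^2(i)s^2\frac{\partial^2\eta_i}{\partial s^2}=r(i)\eta_i$ on $(0,T)\times(0,\infty)$, $\eta_i(T,s)=(s-K)^+$, $\lim_{s\downarrow0}\eta_i(t,s)=0$ for all $t\in[0,T]$. Let $\mathcal{D}:=\{(t,s,i,y)\in(0,T)\times(0,\infty)\times\mathcal{X}\times(0,T):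 y\in(0,t)\}$ and $\overline{\mathcal{D}}:=\{(t,s,i,y): t\in[0,T],\ s\in(0,\infty),\ i\in\mathcal{X},\ y\in[0,t]\}$. Functions on $\mathcal{D}$ are understood to be continuous up to $\overline{\mathcal{D}}$, so that the values at $y=0$ and $t=T$ make sense. A classical solution is such a function in $C^{1,2,1}(\mathcal{D})$ (continuously differentiable in $t$, twice in $s$, once in $y$) satisfying the equation and conditions pointwise. At most linear growth means $\sup_{\mathcal{D}}|\varphi(t,s,i,y)/(1+s)|<\infty$. *)

(* Defs.v *)
From HB Require Import structures.
From mathcomp Require Import all_boot all_order all_algebra.
From mathcomp Require Import all_classical all_reals all_analysis.

Set Implicit Arguments.
Unset Strict Implicit.
Unset Printing Implicit Defensive.

Import Order.TTheory GRing.Theory Num.Theory.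
Import numFieldNormedType.Exports.

Local Open Scope classical_set_scope.
Local Open Scope ring_scope.

(* Functions given on [0, +oo[, on D or on its closure are encoded as total
   functions; every condition below only constrains their values on the
   intended domain. *)

(* Differentiability on [0, +oo[: two-sided at y > 0 and, because the increment
   h must keep y + h in the domain, one-sided at y = 0. *)
Definition differentiable_on_nonneg (R : realType) (g : R -> R) : Prop :=
  forall y : R, 0 <= y ->
    cvg ((fun h => h^-1 * (g (y + h) - g y)) @ within [set h | 0 <= y + h] 0^').

Section semi_markov.
Context (R : realType) (k : nat).

(* Only the values lam i j y with i != j and 0 <= y are meaningful; the
   diagonal entry lambda_ii is [lam_diag]. *)
Variable lam : 'I_k -> 'I_k -> R -> R.

Definition lam_diag (i : 'I_k) (y : R) : R := - \sum_(j < k | j != i) lam i j y.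

Definition Lam (i : 'I_k) (y : R) : R :=
  \int[lebesgue_measure]_(v in `[0, y]) `|lam_diag i v|.

Definition F (y : R) (i : 'I_k) : R := 1 - expR (- Lam i y).

(* The two-sided derivative: its value at y = 0 is not meaningful, but f is only
   evaluated at y > 0 or under an integral. *)
Definition f (y : R) (i : 'I_k) : R := derive1 (fun x => F x i) y.

Definition p (i j : 'I_k) (y : R) : R :=
  if j == i then 0 else lam i j y / `|lam_diag i y|.

(* dF(y | i) = f(y | i) dy: F( . | i) is continuously differentiable and
   vanishes at 0. *)
Definition phat : 'M[R]_k :=
  \matrix_(i, j) \int[lebesgue_measure]_(y in `[0, +oo[) (p i j y * f y i).

End semi_markov.

Definition irreducible_mx (R : realType) (k : nat) (P : 'M[R]_k) : Prop :=
  forall i j, exists n : nat, 0 < (P ^+ n) i j.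

Definition call_payoff (R : realType) (K s : R) : R := Num.max (s - K) 0.

Section option_price.
Context (R : realType) (T K : R).

Definition bsm_dom : set (R * R) :=
  [set q | 0 < q.1 < T /\ 0 < q.2].

Definition bsm_cldom : set (R * R) :=
  [set q | 0 <= q.1 <= T /\ 0 < q.2].

(* The classical solution, with coefficients r and sigma, as a function
   eta t s continuous up to [0, T] x ]0, +oo[. *)
Record bsm_solution (r sigma : R) (eta : R -> R -> R) : Prop := BsmSolution {
  bsm_cont : {within bsm_cldom, continuous (fun q => eta q.1 q.2)} ;
  bsm_derivable_t : forall t s, bsm_dom (t, s) ->
    derivable (fun x => eta x s) t 1 ;
  bsm_derivable_s : forall t s, bsm_dom (t, s) -> derivable (eta t) s 1 ;
  bsm_derivable_ss : forall t s, bsm_dom (t, s) ->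
    derivable (derive1 (eta t)) s 1 ;
  bsm_cont_t :
    {within bsm_dom, continuous (fun q => derive1 (fun x => eta x q.2) q.1)} ;
  bsm_cont_s : {within bsm_dom, continuous (fun q => derive1 (eta q.1) q.2)} ;
  bsm_cont_ss :
    {within bsm_dom, continuous (fun q => derive1n 2 (eta q.1) q.2)} ;
  bsm_pde : forall t s, bsm_dom (t, s) ->
    derive1 (fun x => eta x s) t + r * s * derive1 (eta t) s
      + 2^-1 * sigma ^+ 2 * s ^+ 2 * derive1n 2 (eta t) s
    = r * eta t s ;
  bsm_terminal : forall s : R, 0 < s -> eta T s = call_payoff K s ;
  bsm_boundary : forall t : R, 0 <= t <= T -> eta t s @[s --> 0^'+] --> (0 : R) ;
  bsm_growth :
    has_ubound [set `|eta q.1 q.2 / (1 + q.2)| | q in bsm_dom]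
}.

(* Points of D and of its closure, for a fixed state i, are written
   ((t, s), y). *)
Definition dom : set (R * R * R) :=
  [set q | [/\ 0 < q.1.1 < T, 0 < q.1.2, 0 < q.2 < T & 0 < q.2 < q.1.1]].

Definition cldom : set (R * R * R) :=
  [set q | [/\ 0 <= q.1.1 <= T, 0 < q.1.2 & 0 <= q.2 <= q.1.1]].

Context (k : nat).
Implicit Type phi : R -> R -> 'I_k -> R -> R.

Definition pd_t phi t s i y : R := derive1 (fun x => phi x s i y) t.
Definition pd_s phi t s i y : R := derive1 (fun x => phi t x i y) s.
Definition pd_ss phi t s i y : R := derive1n 2 (fun x => phi t x i y) s.
Definition pd_y phi t s i y : R := derive1 (fun x => phi t s i x) y.

Record C121 phi : Prop := MkC121 {
  C121_derivable_t : forall t s i y, dom (t, s, y) ->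
    derivable (fun x => phi x s i y) t 1 ;
  C121_derivable_s : forall t s i y, dom (t, s, y) ->
    derivable (fun x => phi t x i y) s 1 ;
  C121_derivable_ss : forall t s i y, dom (t, s, y) ->
    derivable (fun x => pd_s phi t x i y) s 1 ;
  C121_derivable_y : forall t s i y, dom (t, s, y) ->
    derivable (fun x => phi t s i x) y 1 ;
  C121_cont_t : forall i,
    {within dom, continuous (fun q => pd_t phi q.1.1 q.1.2 i q.2)} ;
  C121_cont_s : forall i,
    {within dom, continuous (fun q => pd_s phi q.1.1 q.1.2 i q.2)} ;
  C121_cont_ss : forall i,
    {within dom, continuous (fun q => pd_ss phi q.1.1 q.1.2 i q.2)} ;
  C121_cont_y : forall i,
    {within dom, continuous (fun q => pd_y phi q.1.1 q.1.2 i q.2)}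
}.

Definition continuous_up_to_closure phi : Prop := forall i,
  {within cldom, continuous (fun q => phi q.1.1 q.1.2 i q.2)}.

Definition at_most_linear_growth phi : Prop :=
  has_ubound [set z | exists t s i y,
    dom (t, s, y) /\ z = `|phi t s i y / (1 + s)|].

Context (r sigma : 'I_k -> R) (lam : 'I_k -> 'I_k -> R -> R).

Record price_solution phi : Prop := PriceSolution {
  price_cont : continuous_up_to_closure phi ;
  price_C121 : C121 phi ;
  price_pde : forall t s i y, dom (t, s, y) ->
    pd_t phi t s i y + pd_y phi t s i y + r i * s * pd_s phi t s i y
      + 2^-1 * sigma i ^+ 2 * s ^+ 2 * pd_ss phi t s i y
      + \sum_(j < k | j != i) lam i j y * (phi t s j 0 - phi t s i y)
    = r i * phi t s i y ;
  price_boundary : forall (t : R) (i : 'I_k) (y : R), 0 <= t <= T -> 0 <= y <= t ->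
    phi t s i y @[s --> 0^'+] --> (0 : R) ;
  price_terminal : forall (s : R) (i : 'I_k) (y : R), 0 < s -> 0 <= y <= T ->
    phi T s i y = call_payoff K s ;
  price_growth : at_most_linear_growth phi
}.

(* ln(x/s) - (r(i) - sigma(i)^2/2) v *)
Definition log_dev (i : 'I_k) (s v x : R) : R :=
  ln (x / s) - (r i - sigma i ^+ 2 / 2) * v.

Definition psi (eta : 'I_k -> R -> R -> R) phi (t s : R) (i : 'I_k) (y : R)
    : R :=
  (1 - F lam (T - t + y) i) / (1 - F lam y i) * derive1 (eta i t) s
  + \int[lebesgue_measure]_(v in `[0, T - t])
      (expR (- r i * v) * (f lam (y + v) i / (1 - F lam y i))
       * \sum_(j < k | j != i)
           (p lam i j (y + v)
            * \int[lebesgue_measure]_(x in `]0, +oo[)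
                (phi (t + v) x j 0
                 * (expR (- 2^-1
                      * (log_dev i s v x * (sigma i * Num.sqrt v)^-1) ^+ 2)
                    / (Num.sqrt (2 * pi) * x * s * sigma i * Num.sqrt v))
                 * (log_dev i s v x / (sigma i ^+ 2 * v))))).

End option_price.

(* Main.v *)
Require Import Defs.
From HB Require Import structures.
From mathcomp Require Import all_boot all_order all_algebra.
From mathcomp Require Import all_classical all_reals all_analysis.
From mathcomp Require Import measurable_realfun.
From mathcomp Require Import ring lra.

(** Fix a point (t0, s0, i, y0) of D. With S = 1 - F( . | i), the function
    S(y) phi(t,s,i,y) - S(T - t0 + y0) eta_i(t,s), followed along the
    characteristic (t0 + v, y0 + v) in the space variable
    s = s0 exp((r - sigma^2/2) v + sigma z) and discounted by exp(-r v), becomes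
    a function W(v,z) with W_v + W_zz / 2 = - H and W = 0 at v = T - t0, where H
    is the term coming from the jumps, and W_z(0,0) is, up to a factor, the
    difference of the s-derivatives to be computed. The kernel
    q = (z/v) exp(-z^2/(2v)) / sqrt(2 pi v) solves q_v = q_zz / 2, and pairing it
    with W at v -> 0 gives W_z(0,0); so the derivative of v |-> int W q dz yields
    W_z(0,0) = int int H q dz dv. This bypasses both a representation of phi
    itself and differentiation in s under the integral. No bound is known on the
    derivatives of W, so the pairing is done on [-N,N] with the weight
    (1 - z^2/N^2)^2, which removes all boundary terms and costs an error of
    order N^-2. *)

Set Implicit Arguments.
Unset Strict Implicit.
Unset Printing Implicit Defensive.

Import Order.TTheory GRing.Theory Num.Theory.
Import numFieldNormedType.Exports.

Local Open Scope classical_set_scope.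
Local Open Scope ring_scope.

(** * Integration on segments *)

(** The factor S is used because S' = - [total_rate] S: it absorbs the loss term of the jump sum, so
    that only the inflow from the other states remains as a source. The number S(T - t0 + y0) is a
    constant, so its multiple of eta_i still solves the Black-Scholes-Merton equation; and it is the
    value of S where this one characteristic meets maturity, so the two payoffs, kink included,
    cancel there. The kernel q has L^1 norm of order v^(-1/2). Every error made by the weight must
    keep this rate, since v^(-1) would not be integrable at 0. Smoothness is known only for 0 < t <
    T, so the fundamental theorem of calculus is applied on segments inside ]0, T - t0[ whose
    endpoints are chosen after N. The time v = 0, in contrast, is interior: the characteristic
    extends back to v = - y0, which gives joint continuity of W and W_z at v = 0. *)

Section integral_tools.
Context {R : realType}.
Notation mu := (@lebesgue_measure R).

Lemma itv_within_continuous (f : R -> R) (a b : R) :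
  (forall x, a <= x <= b -> {for x, continuous f}) ->
  {within `[a, b], continuous f}.
Proof.
move=> cf; apply: continuous_in_subspaceT => x /set_mem/=.
by rewrite in_itv/= => ?; exact: cf.
Qed.

Lemma itv_continuous_integrable (f : R -> R) (a b : R) :
  (forall x, a <= x <= b -> {for x, continuous f}) ->
  mu.-integrable `[a, b] (EFin \o f).
Proof.
move=> cf; apply: continuous_compact_integrable; first exact: segment_compact.
exact: itv_within_continuous.
Qed.

Lemma Rintegral_FTC2 (f F : R -> R) (a b : R) : a < b ->
  (forall x, a <= x <= b -> {for x, continuous f}) ->
  (forall x, a <= x <= b -> is_derive x 1 F (f x)) ->
  \int[mu]_(x in `[a, b]) f x = F b - F a.
Proof.
move=> ab cf dF.
have cF x : a <= x <= b -> {for x, continuous F}.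
  move=> /dF dFx; apply/differentiable_continuous/derivable1_diffP.
  exact: ex_derive.
have [acb bcb] : a <= a <= b /\ a <= b <= b by rewrite !lexx (ltW ab).
rewrite /Rintegral (@continuous_FTC2 _ f F)//.
- exact: itv_within_continuous.
- split.
  + by move=> x; rewrite in_itv/= => /andP[ax xb]; have := dF x;
      rewrite !ltW// => /(_ isT) dFx; exact: ex_derive.
  + exact/cvg_at_right_filter/cF.
  + exact/cvg_at_left_filter/cF.
- move=> x; rewrite in_itv/= => /andP[ax xb]; rewrite derive1E.
  by have := dF x; rewrite !ltW// => /(_ isT) dFx; rewrite derive_val.
Qed.

Lemma Rintegral_dominated_cvg (D : set R) (f_ : nat -> R -> R) (f g : R -> R) :
  measurable D ->
  (forall n, measurable_fun D (f_ n)) ->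
  (forall x, D x -> f_ n x @[n --> \oo] --> f x) ->
  mu.-integrable D (EFin \o g) ->
  (forall n x, D x -> `|f_ n x| <= g x) ->
  mu.-integrable D (EFin \o f) /\
  \int[mu]_(x in D) f_ n x @[n --> \oo] --> \int[mu]_(x in D) f x.
Proof.
move=> mD mf_ f_f ig f_g.
have f_f' : {ae mu, forall x, D x ->
    (fun n => (EFin \o f_ n) x) @ \oo --> (EFin \o f) x}.
  apply: aeW => x Dx.
  by apply: cvg_EFin; [exact: nearW|exact: f_f].
have mf_' n : measurable_fun D (fun x => (f_ n x)%:E) by exact/measurable_EFinP.
have mf : measurable_fun D (fun x => (f x)%:E).
  apply: (emeasurable_fun_cvg (fun n x => (f_ n x)%:E)) => // x Dx.
  by apply: cvg_EFin; [exact: nearW|exact: f_f].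
have f_g' : {ae mu, forall x n, D x -> (`|(EFin \o f_ n) x| <= (EFin \o g) x)%E}.
  by apply: aeW => x n Dx; rewrite /= lee_fin f_g.
have [intf _ cvf] :=
  @dominated_convergence _ _ _ mu D mD _ _ _ mf_' mf f_f' ig f_g'.
split=> //; apply: fine_cvg.
have -> : (fine (\int[mu]_(x in D) (f x)%:E)%E)%:E = (\int[mu]_(x in D) (f x)%:E)%E.
  by rewrite fineK//; exact: integrable_fin_num.
exact: cvf.
Qed.

(** The function stays curried, so that its partial derivatives are plain [is_derive] statements
    about [g v] and [g^~ z]; only continuity needs the pair. *)
Definition continuous2_at (g : R -> R -> R) (v z : R) : Prop :=
  {for (v, z), continuous (fun p : R * R => g p.1 p.2)}.

Lemma continuous2_at_fst (g : R -> R -> R) v z :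
  continuous2_at g v z -> {for v, continuous (g^~ z)}.
Proof.
move=> cg.
have h : (x, z) @[x --> v] --> (v, z).
  by apply: (@cvg_pair _ _ _ _ (nbhs v) (nbhs z)); [exact: cvg_id|exact: cvg_cst].
exact: (cvg_comp _ (fun p : R * R => g p.1 p.2) h cg).
Qed.

Lemma continuous2_at_snd (g : R -> R -> R) v z :
  continuous2_at g v z -> {for z, continuous (g v)}.
Proof.
move=> cg.
have h : (v, x) @[x --> z] --> (v, z).
  by apply: (@cvg_pair _ _ _ _ (nbhs v) (nbhs z)); [exact: cvg_cst|exact: cvg_id].
exact: (cvg_comp _ (fun p : R * R => g p.1 p.2) h cg).
Qed.

Lemma box_bounded (g : R -> R -> R) (a b c d : R) :
  (forall v z, a <= v <= b -> c <= z <= d -> continuous2_at g v z) ->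
  exists2 M, 0 <= M & forall v z, a <= v <= b -> c <= z <= d -> `|g v z| <= M.
Proof.
move=> cg.
(* The extreme value theorem needs a point of the box; an empty box is treated apart, with bound
   0. *)
have [[p0 [p01 p02]]|nbox] := pselect (`[a, b] `*` `[c, d] !=set0); last first.
  exists 0 => // v z vab zcd; exfalso; apply: nbox; exists (v, z).
  by split => /=; rewrite in_itv.
have cabs : {within `[a, b] `*` `[c, d],
    continuous (fun p : R * R => `|g p.1 p.2|)}.
  apply: continuous_in_subspaceT => -[v z] /set_mem[/=].
  rewrite !in_itv/= => vab zcd.
  apply: (cvg_comp (fun p : R * R => g p.1 p.2) Num.norm); first exact: cg.
  exact: norm_continuous.
have cbox : compact (`[a, b] `*` `[c, d] : set (R * R)).
  by apply: compact_setX; exact: segment_compact.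
have box0 : (`[a, b] `*` `[c, d] : set (R * R)) !=set0 by exists p0.
have [p pA pmax] := compact_EVT_max box0 cbox cabs.
exists `|g p.1 p.2| => // v z vab zcd; apply: (pmax (v, z)).
by apply/mem_set; split => /=; rewrite in_itv.
Qed.

(** Differentiation in v is local: around a given v a compact subinterval of ]a, b[ is enough, and
    there [g'] is bounded by compactness, so a constant dominates. Continuity of the derivative is
    included because the fundamental theorem will be applied to it. *)
Lemma Leibniz_rule (g g' : R -> R -> R) (a b c d : R) :
  (forall v z, a < v < b -> c <= z <= d -> is_derive v 1 (g^~ z) (g' v z)) ->
  (forall v z, a < v < b -> c <= z <= d -> {for z, continuous (g v)}) ->
  (forall v z, a < v < b -> c <= z <= d -> continuous2_at g' v z) ->
  forall v, a < v < b ->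
  is_derive v 1 (fun v => \int[mu]_(z in `[c, d]) g v z)
                (\int[mu]_(z in `[c, d]) g' v z) /\
  {for v, continuous (fun v => \int[mu]_(z in `[c, d]) g' v z)}.
Proof.
move=> dg cg cg' v /andP[av vb].
pose a' := (a + v) / 2; pose b' := (v + b) / 2.
have [aa' a'v vb' b'b] : [/\ a < a', a' < v, v < b' & b' < b].
  by rewrite /a' /b'; split; lra.
have sub x : `]a', b'[%classic x -> a < x < b.
  by rewrite /= in_itv/= => /andP[a'x xb']; apply/andP; split; lra.
have Iv : `]a', b'[%classic v by rewrite /= in_itv/= a'v vb'.
have [M M0 Mg] : exists2 M, 0 <= M & forall v z, a' <= v <= b' ->
    c <= z <= d -> `|g' v z| <= M.
  apply: box_bounded => x z /andP[a'x xb'] zcd; apply: cg' => //.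
  by apply/andP; split; lra.
have ig x : `]a', b'[%classic x -> mu.-integrable `[c, d] (EFin \o g x).
  by move=> /sub abx; apply: itv_continuous_integrable => z zcd; exact: cg.
have ig' x : `]a', b'[%classic x -> mu.-integrable `[c, d] (EFin \o g' x).
  move=> /sub abx; apply: itv_continuous_integrable => z zcd.
  exact/continuous2_at_snd/cg'.
have iM : mu.-integrable `[c, d] (EFin \o cst M).
  by apply: itv_continuous_integrable => z _; exact: cvg_cst.
have dg' x y : `]a', b'[%classic x -> `[c, d]%classic y -> derivable (g^~ y) x 1.
  move=> /sub abx; rewrite /= in_itv/= => ycd.
  by have dgx := dg _ _ abx ycd; exact: ex_derive.
have g'E x y : `]a', b'[%classic x -> `[c, d]%classic y ->
    partial1of2 g x y = g' x y.
  move=> /sub abx; rewrite /= in_itv/= => ycd; rewrite partial1of2E.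
  by have dgx := dg _ _ abx ycd; rewrite derive_val.
have subcc x : `]a', b'[%classic x -> a' <= x <= b'.
  by rewrite /= in_itv/= => /andP[? ?]; rewrite !ltW.
have Gub x y : `]a', b'[%classic x -> `[c, d]%classic y ->
    `|partial1of2 g x y| <= cst M y.
  move=> ax cy; rewrite g'E//; apply: Mg; first exact: subcc.
  by move: cy; rewrite /= in_itv.
split.
- apply: DeriveDef.
    exact: (derivable_under_integral _ Iv ig dg' _ iM Gub).
  rewrite -derive1E (differentiation_under_integral _ Iv ig dg' _ iM Gub)//.
  by apply: eq_Rintegral => z /set_mem cz; rewrite g'E.
- have cg'2 : {ae mu, forall z, `[c, d]%classic z ->
      {in (`]a', b'[%classic : set R), continuous (g'^~ z)}}.
    apply: aeW => z; rewrite /= in_itv/= => zcd x /set_mem/sub abx.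
    exact/continuous2_at_fst/cg'.
  have Mg' x : `]a', b'[%classic x ->
      {ae mu, forall z, `[c, d]%classic z -> `|g' x z| <= cst M z}.
    move=> ax; apply: aeW => z; rewrite /= in_itv/= => zcd.
    by apply: Mg => //; exact: subcc.
  by apply: (continuity_under_integral _ ig' cg'2 iM Mg'); rewrite ?inE.
Qed.

End integral_tools.

(** * Joint continuity of functions of two real variables *)

Section continuity2.
Context {R : realType}.
Implicit Types g h : R -> R -> R.

Lemma continuous2_at_cst (c v z : R) : continuous2_at (fun _ _ => c) v z.
Proof. exact: cvg_cst. Qed.

Lemma continuous2_at_of_fst (f : R -> R) (v z : R) : {for v, continuous f} ->
  continuous2_at (fun x _ => f x) v z.
Proof. by move=> cf; apply: (cvg_comp fst f) cf; exact: cvg_fst. Qed.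

Lemma continuous2_at_of_snd (f : R -> R) (v z : R) : {for z, continuous f} ->
  continuous2_at (fun _ x => f x) v z.
Proof. by move=> cf; apply: (cvg_comp snd f) cf; exact: cvg_snd. Qed.

Lemma continuous2_at_comp (f : R -> R) g (v z : R) :
  continuous2_at g v z -> {for g v z, continuous f} ->
  continuous2_at (fun x y => f (g x y)) v z.
Proof. by move=> cg cf; apply: (cvg_comp _ f cg) cf. Qed.

Lemma continuous2_atD g h (v z : R) :
  continuous2_at g v z -> continuous2_at h v z ->
  continuous2_at (fun x y => g x y + h x y) v z.
Proof. by move=> cg ch; exact: (cvgD cg ch). Qed.

Lemma continuous2_atB g h (v z : R) :
  continuous2_at g v z -> continuous2_at h v z ->
  continuous2_at (fun x y => g x y - h x y) v z.
Proof. by move=> cg ch; exact: (cvgB cg ch). Qed.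

Lemma continuous2_atN g (v z : R) :
  continuous2_at g v z -> continuous2_at (fun x y => - g x y) v z.
Proof. by move=> cg; exact: (cvgN cg). Qed.

Lemma continuous2_atM g h (v z : R) :
  continuous2_at g v z -> continuous2_at h v z ->
  continuous2_at (fun x y => g x y * h x y) v z.
Proof. by move=> cg ch; exact: (cvgM cg ch). Qed.

End continuity2.

(** * The time singularity v^(-1/2) *)

Section improper.
Context {R : realType}.
Notation mu := (@lebesgue_measure R).

(** Exhaust ]0, b[ by segments, on which 2 sqrt v is a primitive: all their integrals are at most 2
    sqrt b, and monotone convergence carries this bound to the limit. *)
Lemma integrable_inv_sqrt (b : R) : 0 < b ->
  mu.-integrable `]0, b[ (EFin \o (fun v => (Num.sqrt v)^-1)).
Proof.
move=> b0; set f := fun v : R => (Num.sqrt v)^-1.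
have cf v : 0 < v -> {for v, continuous f}.
  move=> v0; apply: cvgV; last exact: sqrt_continuous.
  by rewrite gt_eqF// sqrtr_gt0.
have mf : measurable_fun (`]0, b[ : set R) f.
  apply: open_continuous_measurable_fun; first exact: interval_open.
  by move=> x /set_mem/=; rewrite in_itv/= => /andP[x0 _]; exact: cf.
have f0 v : 0 <= f v by rewrite invr_ge0 sqrtr_ge0.
apply/integrableP; split; first exact/measurable_EFinP.
have -> : (\int[mu]_(x in `]0%R, b[) `|(EFin \o f) x| =
           \int[mu]_(x in `]0%R, b[) (f x)%:E)%E.
  by apply: eq_integral => x _; rewrite /= ger0_norm.
(* Dividing by n + 3 gives [2 * e n < b] already at n = 0, so no segment of the exhaustion is
   degenerate. *)
pose e (n : nat) : R := b / n.+3%:R.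
have e0 n : 0 < e n by rewrite divr_gt0.
have eb n : e n < b - e n.
  have : 2 * e n < b; last by lra.
  rewrite /e mulrCA gtr_pMr// ltr_pdivrMr// mul1r -natr1 -natr1.
  by have := ler0n R n; lra.
pose D n : set R := `[e n, b - e n]%classic.
have eS : forall n m, (n <= m)%N -> e m <= e n.
  move=> n m nm; rewrite /e ler_pM2l// lef_pV2 ?posrE// ler_nat.
  by rewrite !ltnS.
have DU : `]0, b[%classic = \bigcup_n D n.
  apply/seteqP; split => [x|x [n _]]; rewrite /D /= !in_itv/=; last first.
    by move=> /andP[? ?]; have := e0 n; have := eb n; lra.
  move=> /andP[x0 xb].
  have e_cvg : e n @[n --> \oo] --> 0.
    rewrite -[X in _ --> X](mulr0 b); apply: cvgM; first exact: cvg_cst.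
    have /= := @cvg_harmonic R.
    rewrite -(cvg_shiftn 2) /harmonic; apply: cvg_trans.
    by apply: near_eq_cvg; apply: nearW => n /=; rewrite addn2.
  have [n1 _ n1P] : \forall n \near \oo, e n < x by exact: (cvgr_lt 0 e_cvg).
  have bx0 : 0 < b - x by lra.
  have [n2 _ n2P] : \forall n \near \oo, e n < b - x.
    exact: (cvgr_lt 0 e_cvg).
  exists (maxn n1 n2) => //; rewrite /= in_itv/=.
  have := n1P (maxn n1 n2) (leq_maxl _ _); have := n2P (maxn n1 n2) (leq_maxr _ _).
  by move=> /= ? ?; apply/andP; split; lra.
have cvD : (\int[mu]_(x in D n) (f x)%:E @[n --> \oo] -->
    \int[mu]_(x in `]0%R, b[) (f x)%:E)%E.
  rewrite DU.
  apply: ge0_nondecreasing_set_cvg_integral => //.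
  - move=> n m nm; apply/subsetPset => x; rewrite /D /= !in_itv/=.
    by have := eS _ _ nm => ? /andP[? ?]; apply/andP; split; lra.
  - by move=> i; exact: measurable_itv.
  - move=> i; apply/measurable_EFinP; apply: measurable_funS mf => //.
    by rewrite DU; exact: bigcup_sup.
  - by move=> i x _; rewrite lee_fin.
suff : (\int[mu]_(x in `]0%R, b[) (f x)%:E <= (2 * Num.sqrt b)%:E)%E.
  by move=> h; apply: le_lt_trans h _; rewrite ltry.
rewrite -(cvg_lim _ cvD)//; apply: lime_le; first by apply/cvg_ex; eexists; exact: cvD.
apply: nearW => n.
have cfn x : e n <= x <= b - e n -> {for x, continuous f}.
  by move=> /andP[ex _]; apply: cf; apply: lt_le_trans ex.
have ifn := itv_continuous_integrable cfn.
have fn : (\int[mu]_(x in D n) (f x)%:E)%E \is a fin_num.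
  by apply: integrable_fin_num => //; exact: measurable_itv.
have E : \int[mu]_(x in D n) f x = 2 * Num.sqrt (b - e n) - 2 * Num.sqrt (e n).
  apply: (@Rintegral_FTC2 _ f (fun x => 2 * Num.sqrt x)) => // x /andP[ex _].
  have x0 := lt_le_trans (e0 n) ex; have dx := is_derive1_sqrt x0.
  have s0 : Num.sqrt x != 0 by rewrite gt_eqF// sqrtr_gt0.
  by apply: is_derive_eq; rewrite /f /GRing.scale/=; field.
rewrite -(fineK fn) -/(Rintegral _ _ _) E lee_fin.
have : Num.sqrt (b - e n) <= Num.sqrt b by rewrite ler_sqrt; have := e0 n; lra.
by have := sqrtr_ge0 (e n); lra.
Qed.

End improper.

(** * The heat kernel *)

Section heat_kernel.
Context {R : realType}.
Notation mu := (@lebesgue_measure R).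
Implicit Types v z : R.

Definition heat v z : R :=
  (Num.sqrt (2 * pi * v))^-1 * expR (- (z ^+ 2 / (2 * v))).

(** Minus the z-derivative of [heat], the kernel q of the overview; [dipole_z] and [dipole_zz] are
    its first two z-derivatives in closed form. *)
Definition dipole v z : R := z / v * heat v z.
Definition dipole_z v z : R := (v^-1 - z ^+ 2 / v ^+ 2) * heat v z.
Definition dipole_zz v z : R :=
  (z ^+ 3 / v ^+ 3 - 3 * z / v ^+ 2) * heat v z.

Lemma heat_ge0 v z : 0 <= heat v z.
Proof. by rewrite mulr_ge0 ?invr_ge0 ?sqrtr_ge0 ?expR_ge0. Qed.

Lemma is_derive_heat_z v z : 0 < v -> is_derive z 1 (heat v) (- dipole v z).
Proof.
move=> v0; have vn0 : v != 0 by rewrite gt_eqF.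
have dg : is_derive z 1 (fun x => - (x ^+ 2 / (2 * v))) (- (z / v)).
  by apply: is_derive_eq; rewrite /GRing.scale/=; field.
have := @is_derive1_comp _ expR _ _ _ _ (is_derive_expR _) dg.
rewrite /comp => de; rewrite /heat.
by apply: is_derive_eq; rewrite /dipole /heat /GRing.scale/=; ring.
Qed.

Lemma is_derive_dipole_z v z : 0 < v -> is_derive z 1 (dipole v) (dipole_z v z).
Proof.
move=> v0; have vn0 : v != 0 by rewrite gt_eqF.
have dh := is_derive_heat_z z v0; rewrite /dipole.
by apply: is_derive_eq; rewrite /dipole_z /dipole /GRing.scale/=; field.
Qed.

Lemma is_derive_dipole_zz v z : 0 < v ->
  is_derive z 1 (dipole_z v) (dipole_zz v z).
Proof.
move=> v0; have vn0 : v != 0 by rewrite gt_eqF.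
have dh := is_derive_heat_z z v0; rewrite /dipole_z.
by apply: is_derive_eq; rewrite /dipole_zz /dipole /GRing.scale/=; field.
Qed.

(** This is the heat equation: [- dipole_z] is the second z-derivative of [heat]. *)
Lemma is_derive_heat_v v z : 0 < v ->
  is_derive v 1 (heat^~ z) (- 2^-1 * dipole_z v z).
Proof.
move=> v0; have vn0 : v != 0 by rewrite gt_eqF.
have pv0 : 0 < 2 * pi * v by rewrite !mulr_gt0// pi_gt0.
have s0 : Num.sqrt (2 * pi * v) != 0 by rewrite gt_eqF// sqrtr_gt0.
have pn0 : (pi : R) != 0 by rewrite gt_eqF// pi_gt0.
have dl : is_derive v 1 (fun x : R => 2 * pi * x) (2 * pi).
  by apply: is_derive_eq; rewrite /GRing.scale/=; ring.
have ds := @is_derive1_comp _ Num.sqrt _ _ _ _ (is_derive1_sqrt pv0) dl.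
rewrite /comp in ds.
have dis := @is_deriveV _ (fun x => Num.sqrt (2 * pi * x)) _ _ _ s0 ds.
have div : is_derive v 1 (fun x : R => - (z ^+ 2 / (2 * x)))
    (z ^+ 2 / (2 * v ^+ 2)).
  have v20 : 2 * v != 0 by rewrite mulf_neq0.
  have d2 : is_derive v 1 (fun x : R => 2 * x) 2.
    by apply: is_derive_eq; rewrite /GRing.scale/=; ring.
  have di := @is_deriveV _ (fun x => 2 * x) _ _ _ v20 d2.
  by apply: is_derive_eq; rewrite /GRing.scale/=; field.
have de := @is_derive1_comp _ expR _ _ _ _ (is_derive_expR _) div.
rewrite /comp in de; rewrite /heat.
apply: is_derive_eq; rewrite /dipole_z /heat /GRing.scale/=.
have sE : Num.sqrt (2 * pi * v) ^+ 2 = 2 * pi * v by rewrite sqr_sqrtr// ltW.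
set s := Num.sqrt _ in s0 sE *; set e := expR _.
(* Once its square is replaced, the root can be any nonzero number, and a rational identity is left
   for [field]. *)
rewrite sE.
clearbody s e; move: sE; move: (pi : R) pn0 => P Pn0 sE.
by field; rewrite vn0 s0 Pn0.
Qed.

(** As a z-derivative of a solution, [dipole] solves the heat equation as well. *)
Lemma is_derive_dipole_v v z : 0 < v ->
  is_derive v 1 (dipole^~ z) (2^-1 * dipole_zz v z).
Proof.
move=> v0; have vn0 : v != 0 by rewrite gt_eqF.
have dh := is_derive_heat_v z v0.
have di : is_derive v 1 (fun x : R => x^-1) (- v ^- 2).
  have di := @is_deriveV _ id _ _ _ vn0 (is_derive_id v 1).
  by apply: is_derive_eq di _; rewrite /GRing.scale/= mulr1.
rewrite /dipole.
by apply: is_derive_eq; rewrite /dipole_zz /dipole_z /GRing.scale/=; field.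
Qed.

Lemma continuous2_heat v z : 0 < v -> continuous2_at heat v z.
Proof.
move=> v0; have vn0 : v != 0 by rewrite gt_eqF.
have pv0 : 0 < 2 * pi * v by rewrite !mulr_gt0// pi_gt0.
have s0 : Num.sqrt (2 * pi * v) != 0 by rewrite gt_eqF// sqrtr_gt0.
have cl c : {for v, continuous (fun x : R => c * x)}.
  by apply: cvgM; [exact: cvg_cst|exact: cvg_id].
apply: (@continuous2_atM _ (fun v _ => (Num.sqrt (2 * pi * v))^-1)).
  apply: (@continuous2_at_of_fst _ (fun v => (Num.sqrt (2 * pi * v))^-1)).
  apply: cvgV => //.
  have h : {for v, continuous (Num.sqrt \o (fun x : R => 2 * pi * x))}.
    by apply: continuous_comp; [exact: cl|exact: sqrt_continuous].
  exact: h.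
apply: (@continuous2_at_comp _ expR (fun v z => - (z ^+ 2 / (2 * v)))); last first.
  exact: continuous_expR.
apply: continuous2_atN.
apply: (@continuous2_atM _ (fun _ z => z ^+ 2) (fun v _ => (2 * v)^-1)).
  apply: (@continuous2_at_of_snd _ (fun z => z ^+ 2)); exact: exprn_continuous.
apply: (@continuous2_at_of_fst _ (fun v => (2 * v)^-1)).
by apply: cvgV; [rewrite mulf_neq0|exact: cl].
Qed.

Lemma continuous_inv_pow (n : nat) v : 0 < v ->
  {for v, continuous (fun x : R => (x ^+ n)^-1)}.
Proof.
move=> v0; apply: cvgV; last exact: exprn_continuous.
by rewrite expf_neq0// gt_eqF.
Qed.

Lemma continuous2_powV (m n : nat) v z : 0 < v ->
  continuous2_at (fun v z => z ^+ m / v ^+ n) v z.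
Proof.
move=> v0; apply: (@continuous2_atM _ (fun _ z => z ^+ m) (fun v _ => (v ^+ n)^-1)).
  by apply: (@continuous2_at_of_snd _ (fun z => z ^+ m)); exact: exprn_continuous.
by apply: (@continuous2_at_of_fst _ (fun v => (v ^+ n)^-1)); exact: continuous_inv_pow.
Qed.

Lemma continuous2_dipole v z : 0 < v -> continuous2_at dipole v z.
Proof.
move=> v0; apply: continuous2_atM; last exact: continuous2_heat.
exact: (@continuous2_powV 1 1).
Qed.

Lemma continuous2_dipole_z v z : 0 < v -> continuous2_at dipole_z v z.
Proof.
move=> v0; apply: continuous2_atM; last exact: continuous2_heat.
apply: continuous2_atB; last exact: (@continuous2_powV 2 2).
apply: (@continuous2_at_of_fst _ (fun v => v^-1)).
exact: (@continuous_inv_pow 1).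
Qed.

Lemma continuous2_dipole_zz v z : 0 < v -> continuous2_at dipole_zz v z.
Proof.
move=> v0; apply: continuous2_atM; last exact: continuous2_heat.
apply: continuous2_atB; first exact: (@continuous2_powV 3 3).
apply: (@continuous2_atM _ (fun _ z => 3 * z) (fun v _ => (v ^+ 2)^-1)).
  apply: (@continuous2_at_of_snd _ (fun z => 3 * z)).
  by apply: cvgM; [exact: cvg_cst|exact: cvg_id].
by apply: (@continuous2_at_of_fst _ (fun v => (v ^+ 2)^-1)); exact: continuous_inv_pow.
Qed.

Lemma heat_normal_pdf v : 0 < v -> heat v = normal_pdf 0 (Num.sqrt v).
Proof.
move=> v0; have s0 : Num.sqrt v != 0 by rewrite gt_eqF// sqrtr_gt0.
apply/funext => z; rewrite normal_pdfE// /heat /normal_peak /normal_fun.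
rewrite subr0 sqr_sqrtr ?ltW//; congr (_^-1 * expR _).
  by congr Num.sqrt; rewrite mulr2n; ring.
by rewrite mulNr -[v *+ 2]mulr_natl.
Qed.

Lemma integrable_heat v : 0 < v -> mu.-integrable [set: R] (EFin \o heat v).
Proof. by move=> v0; rewrite heat_normal_pdf//; exact: integrable_normal_pdf. Qed.

Lemma Rintegral_heat v : 0 < v -> \int[mu]_z heat v z = 1.
Proof.
by move=> v0; rewrite heat_normal_pdf// /Rintegral integral_normal_pdf.
Qed.

(** Half of the Gaussian exponent is set aside as a spare factor, which can absorb powers and
    exponentials of z while the other half remains a probability density. *)
Lemma heat_double v z : 0 < v ->
  heat v z = Num.sqrt 2 * expR (- (z ^+ 2 / (4 * v))) * heat (2 * v) z.
Proof.
move=> v0; have vn0 : v != 0 by rewrite gt_eqF.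
have pv0 : 0 < 2 * pi * v by rewrite !mulr_gt0// pi_gt0.
rewrite /heat; have -> : 2 * pi * (2 * v) = 2 * (2 * pi * v) by ring.
rewrite (@sqrtrM _ 2 (2 * pi * v))// [(Num.sqrt 2 * _)^-1]invfM.
have -> : expR (- (z ^+ 2 / (2 * v))) =
    expR (- (z ^+ 2 / (4 * v))) * expR (- (z ^+ 2 / (2 * (2 * v)))).
  by rewrite -expRD; congr expR; field.
have s2 : Num.sqrt 2 != 0 :> R by rewrite gt_eqF// sqrtr_gt0.
have s3 : Num.sqrt (2 * pi * v) != 0 by rewrite gt_eqF// sqrtr_gt0.
move: (Num.sqrt 2) (Num.sqrt (2 * pi * v)) s2 s3 => a c a0 c0.
move: (expR _) (expR _) => e1 e2.
by field; rewrite a0 c0.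
Qed.

(** With x = z^2/(4v), the spare factor of [heat_double] gives x exp(-x) <= 1; the 8 is 4 times the
    bound 2 for sqrt 2. It serves as a Chebyshev estimate: mass away from the origin costs O(v). *)
Lemma sqr_heat_le v z : 0 < v -> z ^+ 2 * heat v z <= 8 * v * heat (2 * v) z.
Proof.
move=> v0; rewrite heat_double//.
have := heat_ge0 (2 * v) z; set h := heat _ _ => h0.
set x := z ^+ 2 / (4 * v).
have x0 : 0 <= x by rewrite divr_ge0 ?sqr_ge0// mulr_ge0// ltW.
have zE : z ^+ 2 = 4 * v * x by rewrite /x; field; rewrite gt_eqF.
have s2 : Num.sqrt 2 <= 2 :> R.
  have h4 : Num.sqrt (2 ^+ 2) = 2 :> R by rewrite sqrtr_sqr ger0_norm.
  by rewrite -[leRHS]h4 ler_sqrt ?expr2; lra.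
have xe : x * expR (- x) <= 1.
  by rewrite expRN ler_pdivrMr ?expR_gt0// mul1r; have := expR_ge1Dx x; lra.
have e0 := expR_ge0 (- x).
rewrite zE.
have -> : 4 * v * x * (Num.sqrt 2 * expR (- x) * h) =
  4 * v * Num.sqrt 2 * h * (x * expR (- x)) by ring.
have k0 : 0 <= 4 * v * Num.sqrt 2 * h by rewrite !mulr_ge0 ?sqrtr_ge0// ltW.
apply: le_trans (ler_wpM2l k0 xe) _; rewrite mulr1.
have -> : 8 * v * h = 4 * v * 2 * h by ring.
by rewrite ler_wpM2r// ler_wpM2l// mulr_ge0// ltW.
Qed.

(** Exponential growth of W and H, the kernel, and the extra z^2/v coming from [dipole_z] are
    dominated together by v^(-1/2) times a probability density, uniformly for v <= b. Integration in
    z then leaves v^(-1/2), which is integrable at 0. *)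
Lemma dipole_bound (A b : R) : 0 <= A -> 0 < b -> exists2 C, 0 <= C &
  forall v z, 0 < v <= b ->
  expR (A * `|z|) * (`|dipole v z| * (1 + z ^+ 2 / v)) <=
    C * (Num.sqrt v)^-1 * heat (2 * v) z.
Proof.
move=> A0 b0; set B := A * Num.sqrt b.
exists (2 * (16 ^+ 2 * expR (2 * B ^+ 2))).
  by rewrite mulr_ge0// mulr_ge0 ?expR_ge0// exprn_ge0.
move=> v z /andP[v0 vb].
have sv0 : 0 < Num.sqrt v by rewrite sqrtr_gt0.
have svb : Num.sqrt v <= Num.sqrt b by rewrite ler_sqrt// ltW.
have svE : Num.sqrt v ^+ 2 = v by rewrite sqr_sqrtr// ltW.
set s := Num.sqrt v in sv0 svb svE *.
(* In the scale-free variable u = |z|/sqrt v the powers of v separate: z/v has size u/sqrt v, and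
   z^2/v is u^2. *)
set u := `|z| / s.
have u0 : 0 <= u by rewrite divr_ge0// ltW.
have zE : `|z| = u * s by rewrite /u divfK// gt_eqF.
have z2E : z ^+ 2 = u ^+ 2 * v by rewrite -real_normK ?num_real// zE exprMn svE.
rewrite /dipole normrM (ger0_norm (heat_ge0 _ _)) normrM normfV (gtr0_norm v0) zE.
have -> : z ^+ 2 / v = u ^+ 2 by rewrite z2E mulfK// gt_eqF.
rewrite heat_double// z2E.
have -> : u ^+ 2 * v / (4 * v) = u ^+ 2 / 4 by field; rewrite gt_eqF.
have := heat_ge0 (2 * v) z; set h := heat _ _ => h0.
have -> : u * s / v = u / s by rewrite -svE; field; rewrite gt_eqF.
have s2 : Num.sqrt 2 <= 2 :> R.
  have h4 : Num.sqrt (2 ^+ 2) = 2 :> R by rewrite sqrtr_sqr ger0_norm.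
  by rewrite -[leRHS]h4 ler_sqrt ?expr2; lra.
have s20 := sqrtr_ge0 (2 : R).
(* From (4B - u)^2 >= 0 follows B u <= 2 B^2 + u^2/8. The spare factor exp(- u^2/4) is later split
   into two factors exp(- u^2/8), one for this growth and one for the polynomial. *)
have Au : expR (A * (u * s)) <= expR (2 * B ^+ 2) * expR (u ^+ 2 / 8).
  rewrite -expRD ler_expR.
  have : A * (u * s) <= B * u.
    have -> : A * (u * s) = A * u * s by ring.
    have -> : B * u = A * u * Num.sqrt b by rewrite /B; ring.
    by rewrite ler_wpM2l// mulr_ge0.
  by have := sqr_ge0 (B * 4 - u); lra.
(* Since u <= 1 + u^2, the left side is at most (1 + u^2)^2; then 1 + u^2 <= 16 exp(u^2/16) is
   squared. *)
have pol : u * (1 + u ^+ 2) <= 16 ^+ 2 * expR (u ^+ 2 / 8).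
  have e16 : 1 + u ^+ 2 <= 16 * expR (u ^+ 2 / 16).
    by have := expR_ge1Dx (u ^+ 2 / 16); have := sqr_ge0 u; lra.
  have -> : expR (u ^+ 2 / 8) = expR (u ^+ 2 / 16) ^+ 2.
    by rewrite [RHS]expr2 -expRD; congr expR; field.
  have u1 : u <= 1 + u ^+ 2 by have := sqr_ge0 (u - 1); nra.
  have p1 : 0 <= 1 + u ^+ 2 by rewrite addr_ge0// sqr_ge0.
  apply: le_trans (ler_wpM2r p1 u1) _.
  have := ler_pM p1 p1 e16 e16; set e := expR _; lra.
have e4 : expR (- (u ^+ 2 / 4)) = (expR (u ^+ 2 / 8) * expR (u ^+ 2 / 8))^-1.
  by rewrite -expRD expRN; congr (expR _)^-1; field.
set E := expR (u ^+ 2 / 8) in Au pol e4.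
have E0 : 0 < E by exact: expR_gt0.
set D := expR (2 * B ^+ 2) in Au *.
have D0 : 0 < D by exact: expR_gt0.
have -> : expR (A * (u * s)) * (u / s * (Num.sqrt 2 * expR (- (u ^+ 2 / 4)) * h)
    * (1 + u ^+ 2)) =
  (expR (A * (u * s)) * (u * (1 + u ^+ 2)) * (E * E)^-1) * Num.sqrt 2 * (s^-1 * h).
  by rewrite e4; ring.
rewrite -[leRHS]mulrA ler_wpM2r//; first by rewrite mulr_ge0// invr_ge0 ltW.
have : expR (A * (u * s)) * (u * (1 + u ^+ 2)) * (E * E)^-1 <= 16 ^+ 2 * D.
  rewrite ler_pdivrMr ?mulr_gt0//.
  have -> : 16 ^+ 2 * D * (E * E) = (D * E) * (16 ^+ 2 * E) by ring.
  have p0 : 0 <= u * (1 + u ^+ 2) by rewrite mulr_ge0// addr_ge0// sqr_ge0.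
  exact: (ler_pM (expR_ge0 _) p0 Au pol).
move=> k; apply: le_trans (ler_wpM2r s20 k) _.
have D256 : 0 <= 16 ^+ 2 * D by rewrite mulr_ge0// ltW.
by apply: le_trans (ler_wpM2l D256 s2) _; lra.
Qed.

End heat_kernel.

(** * The heat kernel as an approximate identity *)

Section concentration.
Context {R : realType}.
Notation mu := (@lebesgue_measure R).

Lemma continuous2_at_dist (g : R -> R -> R) (v z e : R) :
  continuous2_at g v z -> 0 < e ->
  exists2 d, 0 < d & forall x y, `|x - v| < d -> `|y - z| < d ->
    `|g x y - g v z| < e.
Proof.
move=> /cvgrPdist_lt cg e0; have := cg _ e0.
move=> /nbhs_ballP[d /= d0 dg]; exists d => // x y xv yz.
rewrite distrC; apply: (dg (x, y)); split; rewrite /= /ball/= distrC//.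
Qed.

(** Near the origin joint continuity makes [g v z] close to [g 0 0]. Elsewhere, including outside
    [-c, c] where the integrand is extended by 0, the deviation is at most a constant times z^2, and
    [sqr_heat_le] makes its mean O(v). The function depends on v because it will contain W at time
    v. *)
Lemma heat_approximates_identity (g : R -> R -> R) (b c M : R) :
  0 < b -> 0 < c ->
  (forall v z, 0 < v < b -> - c <= z <= c -> `|g v z| <= M) ->
  (forall v z, 0 < v < b -> - c <= z <= c -> {for z, continuous (g v)}) ->
  continuous2_at g 0 0 ->
  \int[mu]_(z in `[- c, c]) (g v z * heat v z) @[v --> 0^'+] --> g 0 0.
Proof.
move=> b0 c0 gM cg cg0.
have arith (L x d : R) : 0 <= L -> 0 < x -> x < d / (16 * (L + 1)) ->
    d / 2 + 8 * L * x <= d.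
  move=> L0 x0; have L1 : 0 < 16 * (L + 1) by lra.
  by rewrite ltr_pdivlMr// => h; lra.
apply/cvgrPdist_le => e e0.
have e20 : 0 < e / 2 by rewrite divr_gt0.
have [d d0 gd] := continuous2_at_dist cg0 e20.
(* Within distance [d'] of 0 a point is both in the zone of continuity and inside [-c, c]. *)
pose d' := Num.min d c.
have d'0 : 0 < d' by rewrite lt_min d0.
have d'd : d' <= d by rewrite ge_min lexx.
have d'c : d' <= c by rewrite ge_min lexx orbT.
have M0 : 0 <= M.
  have := gM (b / 2) 0; rewrite !oppr_le0 (ltW c0) => h.
  by apply: le_trans (h _ isT) => //; lra.
(* For |z| >= [d'] the deviation is at most M + |g 0 0| <= K z^2. *)
pose K := (M + `|g 0 0|) / d' ^+ 2.
have K0 : 0 <= K by rewrite divr_ge0 ?addr_ge0 ?sqr_ge0.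
near=> v.
have v0 : 0 < v by near: v; exact: nbhs_right_gt.
have vb : v < b by near: v; exact: nbhs_right_lt.
have vd : v < d by near: v; exact: nbhs_right_lt.
have vK : v < e / (16 * (K + 1)).
  near: v; apply: nbhs_right_lt; rewrite divr_gt0// mulr_gt0//; lra.
have v0b : 0 < v < b by rewrite v0.
have v20 : 0 < 2 * v by rewrite mulr_gt0.
have igh : mu.-integrable `[- c, c] (EFin \o (fun z => g v z * heat v z)).
  apply: itv_continuous_integrable => z zc; apply: cvgM; first exact: cg.
  exact/continuous2_at_snd/continuous2_heat.
pose k z := ((fun z => g v z * heat v z) \_ `[- c, c]) z - g 0 0 * heat v z.
have ih := integrable_heat v0.
have igh' : mu.-integrable [set: R]
    (EFin \o ((fun z => g v z * heat v z) \_ `[- c, c])).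
  rewrite -restrict_EFin; apply/integrable_restrict => //=.
  by rewrite setTI.
have ig0 : mu.-integrable [set: R] (EFin \o (fun z => g 0 0 * heat v z)).
  exact: (integrableZl _ (g 0 0) ih).
have ik : mu.-integrable [set: R] (EFin \o k).
  exact: (integrableB _ igh' ig0).
have -> : g 0 0 - \int[mu]_(z in `[- c, c]) (g v z * heat v z) =
    - \int[mu]_z k z.
  rewrite RintegralB// RintegralZl// Rintegral_heat// mulr1 opprB.
  by rewrite -Rintegral_mkcond.
rewrite normrN; apply: le_trans (le_normr_Rintegral _ ik) _ => //.
(* Near part plus far part, as multiples of two densities of mass 1: the integral is e/2 + 8 K v. *)
pose B z := e / 2 * heat v z + 8 * K * v * heat (2 * v) z.
have i1 : mu.-integrable [set: R] (EFin \o (fun z => e / 2 * heat v z)).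
  exact: (integrableZl _ (e / 2) ih).
have i2 : mu.-integrable [set: R] (EFin \o (fun z => 8 * K * v * heat (2 * v) z)).
  exact: (integrableZl _ (8 * K * v) (integrable_heat v20)).
have iB : mu.-integrable [set: R] (EFin \o B) by exact: (integrableD _ i1 i2).
have vK0 : 0 <= K * v by rewrite mulr_ge0// ltW.
have K8v : 0 <= 8 * K * v by rewrite -mulrA mulr_ge0.
have kB z : `|k z| <= B z.
  have h0 := heat_ge0 v z; have h20 := heat_ge0 (2 * v) z.
  have sq := sqr_heat_le z v0.
  have kE : `|k z| = `|(g v \_ `[- c, c]) z - g 0 0| * heat v z.
    rewrite /k /patch; case: ifP => _; rewrite -?mulrBl ?sub0r ?normrN;
      by rewrite normrM (ger0_norm h0).
  rewrite kE; have [zd'|zd'] := ltP `|z| d'.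
  - have zc : z \in (`[- c, c]%classic : set R).
      by rewrite inE/= in_itv/= -ler_norml (le_trans (ltW zd')).
    rewrite /patch zc; apply: le_trans (_ : e / 2 * heat v z <= _).
      rewrite ler_wpM2r// ltW//; apply: gd; rewrite subr0.
        by rewrite gtr0_norm.
      exact: (lt_le_trans zd' d'd).
    by rewrite lerDl mulr_ge0.
  - have pM : `|(g v \_ `[- c, c]) z - g 0 0| <= M + `|g 0 0|.
      apply: le_trans (ler_normB _ _) _; rewrite lerD2r /patch.
      by case: ifPn => [|_]; [rewrite inE/= in_itv/= => zc; exact: gM|rewrite normr0].
    apply: le_trans (_ : K * (z ^+ 2 * heat v z) <= _).
      rewrite [leRHS]mulrA ler_wpM2r//; apply: le_trans pM _.
      rewrite /K mulrAC ler_pdivlMr ?exprn_gt0//.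
      rewrite ler_wpM2l ?addr_ge0// -(real_normK (num_real z)).
      by rewrite ler_pXn2r// nnegrE ltW.
    apply: le_trans (ler_wpM2l K0 sq) _.
    have -> : B z = e / 2 * heat v z + K * (8 * v * heat (2 * v) z).
      by rewrite /B; ring.
    by rewrite lerDr mulr_ge0// ltW.
apply: le_trans (_ : \int[mu]_z B z <= _).
  apply: le_Rintegral => //.
  exact: (integrable_norm ik).
have E1 : \int[mu]_z (e / 2 * heat v z) = e / 2.
  by rewrite (RintegralZl _ _ ih)// Rintegral_heat// mulr1.
have E2 : \int[mu]_z (8 * K * v * heat (2 * v) z) = 8 * K * v.
  by rewrite (RintegralZl _ _ (integrable_heat v20))// Rintegral_heat// mulr1.
rewrite (RintegralD _ i1 i2)// E1 E2.
exact: arith.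
Unshelve. all: by end_near. Qed.

End concentration.

(** * The polynomial weight and its error terms *)

Section cutoff.
Context {R : realType}.
Notation mu := (@lebesgue_measure R).
Implicit Types N z v : R.

Definition cutoff N z : R := (1 - z ^+ 2 / N ^+ 2) ^+ 2.
Definition cutoff_z N z : R := - (4 / N ^+ 2 * (1 - z ^+ 2 / N ^+ 2) * z).
Definition cutoff_zz N z : R := 12 * z ^+ 2 / N ^+ 4 - 4 / N ^+ 2.

Lemma is_derive_cutoff N z : 0 < N -> is_derive z 1 (cutoff N) (cutoff_z N z).
Proof.
move=> N0; have Nn0 : N != 0 by rewrite gt_eqF.
rewrite /cutoff.
by apply: is_derive_eq; rewrite /cutoff_z /GRing.scale/=; field.
Qed.

Lemma is_derive_cutoff_z N z : 0 < N ->
  is_derive z 1 (cutoff_z N) (cutoff_zz N z).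
Proof.
move=> N0; have Nn0 : N != 0 by rewrite gt_eqF.
rewrite /cutoff_z.
by apply: is_derive_eq; rewrite /cutoff_zz /GRing.scale/=; field.
Qed.

Lemma continuous_cutoff N z : 0 < N -> {for z, continuous (cutoff N)}.
Proof.
move=> N0; apply/differentiable_continuous/derivable1_diffP.
by have := is_derive_cutoff z N0 => d; exact: ex_derive.
Qed.

Lemma continuous_cutoff_z N z : 0 < N -> {for z, continuous (cutoff_z N)}.
Proof.
move=> N0; apply/differentiable_continuous/derivable1_diffP.
by have := is_derive_cutoff_z z N0 => d; exact: ex_derive.
Qed.

Lemma continuous_cutoff_zz N z : {for z, continuous (cutoff_zz N)}.
Proof.
apply/differentiable_continuous/derivable1_diffP.
by rewrite /cutoff_zz; exact: ex_derive.
Qed.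

Lemma cutoffN N : N != 0 -> cutoff N N = 0 /\ cutoff N (- N) = 0.
Proof.
by move=> N0; rewrite /cutoff sqrrN divff ?expf_neq0// subrr expr0n.
Qed.

Lemma cutoff_zN N : N != 0 -> cutoff_z N N = 0 /\ cutoff_z N (- N) = 0.
Proof.
by move=> N0; rewrite /cutoff_z sqrrN divff ?expf_neq0// subrr mulr0 !mul0r oppr0.
Qed.

Lemma cutoff0 N : cutoff N 0 = 1 /\ cutoff_z N 0 = 0.
Proof.
by rewrite /cutoff /cutoff_z expr0n/= mul0r subr0 expr1n !mulr0 oppr0.
Qed.

Lemma cutoff_ratio N z : 0 < N -> - N <= z <= N -> 0 <= z ^+ 2 / N ^+ 2 <= 1.
Proof.
move=> N0 zN; rewrite divr_ge0 ?sqr_ge0// ler_pdivrMr ?exprn_gt0// mul1r.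
by rewrite -(real_normK (num_real z)) ler_pXn2r ?nnegrE// ?ler_norml// ltW.
Qed.

Lemma cutoff_le1 N z : 0 < N -> - N <= z <= N -> 0 <= cutoff N z <= 1.
Proof.
move=> N0 /(cutoff_ratio N0) /andP[x0 x1]; rewrite /cutoff sqr_ge0/=.
by rewrite expr_le1//; lra.
Qed.

Lemma cutoff_zz_le N z : 0 < N -> - N <= z <= N ->
  `|2^-1 * cutoff_zz N z| <= 8 / N ^+ 2.
Proof.
move=> N0 /(cutoff_ratio N0) /andP[]; set x := z ^+ 2 / N ^+ 2 => x0 x1.
have -> : 2^-1 * cutoff_zz N z = (6 * x - 2) * (N ^+ 2)^-1.
  by rewrite /cutoff_zz /x; field; rewrite gt_eqF.
have i0 : 0 <= (N ^+ 2)^-1 by rewrite invr_ge0 sqr_ge0.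
rewrite normrM (ger0_norm i0) ler_wpM2r// ler_norml; apply/andP; split; lra.
Qed.

(** A bare [dipole_z] has L^1 norm of order v^(-1), which is not integrable at 0. The factor z in
    [cutoff_z] repairs this, since z times [dipole_z] is [dipole] times 1 - z^2/v. *)
Lemma cutoff_dipole_z_le N v z : 0 < N -> 0 < v -> - N <= z <= N ->
  `|cutoff_z N z * dipole_z v z| <=
    4 / N ^+ 2 * (`|dipole v z| * (1 + z ^+ 2 / v)).
Proof.
move=> N0 v0 /(cutoff_ratio N0) /andP[].
have -> : cutoff_z N z * dipole_z v z =
    - (4 / N ^+ 2) * (1 - z ^+ 2 / N ^+ 2) * (dipole v z * (1 - z ^+ 2 / v)).
  by rewrite /cutoff_z /dipole_z /dipole; move: (heat v z) => h; field;
    rewrite !gt_eqF.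
set x := z ^+ 2 / N ^+ 2 => x0 x1.
have y0 : 0 <= z ^+ 2 / v by rewrite divr_ge0 ?sqr_ge0// ltW.
set y := z ^+ 2 / v in y0 *.
have k0 : 0 <= 4 / N ^+ 2 by rewrite divr_ge0 ?sqr_ge0.
rewrite 2!normrM normrN (ger0_norm k0) -mulrA ler_wpM2l//.
rewrite -[leRHS]mul1r ler_pM//; first by rewrite ler_norml; apply/andP; split; lra.
rewrite normrM ler_wpM2l// ler_norml; apply/andP; split; lra.
Qed.

(** The majorant is c times a probability density, so the bound does not depend on the domain; this
    is what makes the estimates uniform in N. *)
Lemma norm_Rintegral_le_heat (D : set R) (F : R -> R) (c w : R) :
  measurable D -> mu.-integrable D (EFin \o F) -> 0 < w -> 0 <= c ->
  (forall z, D z -> `|F z| <= c * heat w z) ->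
  `|\int[mu]_(z in D) F z| <= c.
Proof.
move=> mD iF w0 c0 Fc.
have iFT : mu.-integrable [set: R] (EFin \o (F \_ D)).
  by rewrite -restrict_EFin; apply/integrable_restrict => //=; rewrite setTI.
have ih : mu.-integrable [set: R] (EFin \o (fun z => c * heat w z)).
  exact: (integrableZl _ c (integrable_heat w0)).
rewrite Rintegral_mkcond; apply: le_trans (le_normr_Rintegral _ iFT) _ => //.
have <- : \int[mu]_z (c * heat w z) = c.
  by rewrite (RintegralZl _ _ (integrable_heat w0))// Rintegral_heat// mulr1.
apply: le_Rintegral => //; first exact: (integrable_norm iFT).
move=> z _; rewrite /patch; case: ifPn => [/set_mem/Fc//|_].
by rewrite normr0 mulr_ge0// heat_ge0.
Qed.

End cutoff.

(** * Representation of the space derivative *)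

Section dipole_representation.
Context {R : realType}.
Notation mu := (@lebesgue_measure R).
Context (W Wz Wzz H : R -> R -> R) (J : R -> R) (dl tau A C : R).
Hypotheses (dl0 : 0 < dl) (tau0 : 0 < tau) (A0 : 0 <= A).
Hypothesis dWz : forall v z : R, - dl < v < tau -> is_derive z 1 (W v) (Wz v z).
Hypothesis dWzz : forall v z : R, 0 < v < tau -> is_derive z 1 (Wz v) (Wzz v z).
Hypothesis dWv : forall v z : R, 0 < v < tau ->
  is_derive v 1 (W^~ z) (- H v z - 2^-1 * Wzz v z).
Hypothesis cW : forall v z : R, - dl < v < tau -> continuous2_at W v z.
Hypothesis cWz : forall v z : R, - dl < v < tau -> continuous2_at Wz v z.
Hypothesis cWzz : forall v z : R, 0 < v < tau -> continuous2_at Wzz v z.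
Hypothesis cH : forall v z : R, 0 < v < tau -> continuous2_at H v z.
Hypothesis W_le : forall v z : R, 0 < v < tau -> `|W v z| <= C * expR (A * `|z|).
Hypothesis H_le : forall v z : R, 0 < v < tau -> `|H v z| <= C * expR (A * `|z|).
Hypothesis W_tau : forall z : R, W v z @[v --> tau^'-] --> 0.

Let C0 : 0 <= C.
Proof.
have h : 0 < tau / 2 < tau by have t0 := tau0; lra.
have := W_le 0 h; rewrite normr0 mulr0 expR0 mulr1; exact: le_trans.
Qed.

Let sub v : 0 < v < tau -> - dl < v < tau.
Proof. by have d0 := dl0; move=> /andP[? ->]; rewrite andbT; lra. Qed.

Section fixed_cutoff.
Context (N : R) (N0 : 0 < N).

Let X := cutoff N.
Let Xz := cutoff_z N.
Let Xzz := cutoff_zz N.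

Let I v := \int[mu]_(z in `[- N, N]) (W v z * X z * dipole v z).

(** The v-derivative of the integrand of [I], with W_v replaced by - H - W_zz/2 and q_v by
    q_zz/2. *)
Let dI v z := (- H v z - 2^-1 * Wzz v z) * X z * dipole v z +
  W v z * X z * (2^-1 * dipole_zz v z).

Let D v := \int[mu]_(z in `[- N, N]) dI v z.

Let hH v z := H v z * X z * dipole v z.

(** The terms in which a derivative falls on the weight: the price of truncating to [-N, N]. *)
Let hE v z := W v z * (2^-1 * Xzz z * dipole v z + Xz z * dipole_z v z).

Let cXm v z : continuous2_at (fun _ => X) v z.
Proof. by apply: continuous2_at_of_snd; exact: continuous_cutoff. Qed.

Let cXz v z : continuous2_at (fun _ => Xz) v z.
Proof. by apply: continuous2_at_of_snd; exact: continuous_cutoff_z. Qed.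

Let cXzz v z : continuous2_at (fun _ => Xzz) v z.
Proof. by apply: continuous2_at_of_snd; exact: continuous_cutoff_zz. Qed.

Let cXzm v z : continuous2_at (fun _ z => 2^-1 * Xzz z) v z.
Proof.
by apply: (@continuous2_atM _ (fun _ _ => 2^-1)) => //; exact: continuous2_at_cst.
Qed.

Let chH v z : 0 < v < tau -> continuous2_at hH v z.
Proof.
move=> vt; have /andP[v0 _] := vt.
apply: continuous2_atM; last exact: continuous2_dipole.
by apply: (@continuous2_atM _ H (fun _ => X)) => //; exact: cH.
Qed.

Let chE v z : 0 < v < tau -> continuous2_at hE v z.
Proof.
move=> vt; have /andP[v0 _] := vt.
apply: continuous2_atM; first exact/cW/sub.
apply: continuous2_atD.
  apply: (@continuous2_atM _ (fun _ z => 2^-1 * Xzz z)) => //.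
  exact: continuous2_dipole.
by apply: (@continuous2_atM _ (fun _ => Xz)) => //; exact: continuous2_dipole_z.
Qed.

Let cdI v z : 0 < v < tau -> continuous2_at dI v z.
Proof.
move=> vt; have /andP[v0 _] := vt.
have c2 f : continuous2_at f v z -> continuous2_at (fun x y => 2^-1 * f x y) v z.
  move=> cf; apply: (@continuous2_atM _ (fun _ _ => 2^-1)) => //.
  exact: continuous2_at_cst.
apply: continuous2_atD.
  apply: continuous2_atM; last exact: continuous2_dipole.
  apply: (@continuous2_atM _ _ (fun _ => X)) => //.
  apply: continuous2_atB; first exact/continuous2_atN/cH.
  exact/c2/cWzz.
apply: continuous2_atM; last exact/c2/continuous2_dipole_zz.
by apply: (@continuous2_atM _ W (fun _ => X)) => //; exact/cW/sub.
Qed.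

Let is_derive_I v : 0 < v < tau -> is_derive v 1 I (D v) /\ {for v, continuous D}.
Proof.
move=> vt; apply: (@Leibniz_rule _ _ dI 0 tau) => //.
- move=> x z xt _; have /andP[x0 _] := xt.
  have dw := @dWv x z xt; have dd := is_derive_dipole_v z x0.
  by apply: is_derive_eq; rewrite /dI /GRing.scale/=; ring.
- move=> x z xt _; have /andP[x0 _] := xt.
  apply: cvgM; last exact/continuous2_at_snd/continuous2_dipole.
  apply: cvgM; last exact: continuous_cutoff.
  exact/continuous2_at_snd/cW/sub.
- by move=> x z xt _; exact: cdI.
Qed.

Let int_of2 (h : R -> R -> R) v : (forall z, continuous2_at h v z) ->
  mu.-integrable `[- N, N] (EFin \o h v).
Proof.
move=> ch; apply: itv_continuous_integrable => z _.
exact: continuous2_at_snd.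
Qed.

(** Green's identity for W and q with a weight: the sum of [dI], [hH] and [hE] is an exact
    z-derivative whose primitive vanishes at both ends. The right-hand side contains no derivative
    of W. *)
Let D_split v : 0 < v < tau -> - D v =
  \int[mu]_(z in `[- N, N]) hH v z + \int[mu]_(z in `[- N, N]) hE v z.
Proof.
move=> vt; have /andP[v0 _] := vt.
have Nn0 : N != 0 by rewrite gt_eqF.
have iH := int_of2 (fun z => @chH v z vt).
have iE := int_of2 (fun z => @chE v z vt).
have iD := int_of2 (fun z => @cdI v z vt).
have iHE : mu.-integrable `[- N, N] (EFin \o (fun z => hH v z + hE v z)).
  exact: (integrableD _ iH iE).
apply/eqP; rewrite -subr_eq0 -opprD oppr_eq0 -RintegralD// -RintegralD//; apply/eqP.
(* Each term carries the weight or its slope, and both vanish at N and - N, which are double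
   zeros. *)
pose B z := 2^-1 * (W v z * (Xz z * dipole v z + X z * dipole_z v z)
  - Wz v z * X z * dipole v z).
transitivity (B N - B (- N)); first apply: Rintegral_FTC2; last first.
- rewrite /B; have [XN XNN] := cutoffN Nn0; have [XzN XzNN] := cutoff_zN Nn0.
  by rewrite /X /Xz XN XNN XzN XzNN; ring.
- move=> z _; have dw := dWz (v := v) z (sub vt); have dwz := dWzz (v:=v) z vt.
  have dx := is_derive_cutoff z N0; have dxz := is_derive_cutoff_z z N0.
  have dd := is_derive_dipole_z z v0; have ddz := is_derive_dipole_zz z v0.
  rewrite /B /X /Xz.
  apply: is_derive_eq; rewrite /dI /hH /hE /X /Xz /Xzz /GRing.scale/=.
  by field.
- move=> z _; apply: cvgD; first exact/continuous2_at_snd/cdI.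
  by apply: cvgD; apply/continuous2_at_snd; [exact: chH|exact: chE].
- by rewrite -subr_gt0 opprK addr_gt0.
Qed.

Let hE_le K v z : 0 < v < tau -> - N <= z <= N ->
  expR (A * `|z|) * (`|dipole v z| * (1 + z ^+ 2 / v)) <= K ->
  `|hE v z| <= 12 * C / N ^+ 2 * K.
Proof.
move=> vt zN hK; have /andP[v0 _] := vt.
have zv0 : 0 <= z ^+ 2 / v by rewrite divr_ge0 ?sqr_ge0// ltW.
have i0 : 0 <= (N ^+ 2)^-1 by rewrite invr_ge0 sqr_ge0.
have k1 := cutoff_zz_le N0 zN; have k2 := cutoff_dipole_z_le N0 v0 zN.
have d0 := normr_ge0 (dipole v z).
(* 12 = 8 + 4: the curvature of the weight costs 8/N^2 and its slope against [dipole_z] costs 4/N^2;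
   the first is enlarged by the factor 1 + z^2/v to match the second. *)
have k3 : `|2^-1 * Xzz z * dipole v z + Xz z * dipole_z v z| <=
    12 / N ^+ 2 * (`|dipole v z| * (1 + z ^+ 2 / v)).
  apply: le_trans (ler_normD _ _) _.
  have -> : 12 / N ^+ 2 * (`|dipole v z| * (1 + z ^+ 2 / v)) =
    8 / N ^+ 2 * (`|dipole v z| * (1 + z ^+ 2 / v)) +
    4 / N ^+ 2 * (`|dipole v z| * (1 + z ^+ 2 / v)) by ring.
  apply: lerD k2; rewrite normrM; apply: ler_pM => //.
  by rewrite -[leLHS]mulr1 ler_wpM2l// lerDl.
rewrite /hE normrM; apply: le_trans (ler_pM _ _ (@W_le v z vt) k3) _ => //.
have -> : C * expR (A * `|z|) * (12 / N ^+ 2 * (`|dipole v z| * (1 + z ^+ 2 / v))) =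
  12 * C / N ^+ 2 * (expR (A * `|z|) * (`|dipole v z| * (1 + z ^+ 2 / v))) by ring.
by rewrite ler_wpM2l// mulr_ge0// mulr_ge0.
Qed.

Let hH_le K v z : 0 < v < tau -> - N <= z <= N ->
  expR (A * `|z|) * (`|dipole v z| * (1 + z ^+ 2 / v)) <= K ->
  `|hH v z| <= C * K.
Proof.
move=> vt zN hK; have /andP[v0 _] := vt.
have zv0 : 0 <= z ^+ 2 / v by rewrite divr_ge0 ?sqr_ge0// ltW.
have d0 := normr_ge0 (dipole v z); have /andP[X0 X1] := cutoff_le1 N0 zN.
apply: (@le_trans _ _ (C * (expR (A * `|z|) * (`|dipole v z| * (1 + z ^+ 2 / v))))).
  rewrite mulrA /hH 2!normrM; apply: ler_pM => //.
  - rewrite -[leRHS]mulr1; apply: ler_pM => //; first exact: H_le.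
    by rewrite ger0_norm.
  - by rewrite -[leLHS]mulr1 ler_wpM2l// lerDl.
by rewrite ler_wpM2l.
Qed.

(** Up to a weight error of order N^-2, the negative of the derivative [D0] is the pairing with H.
    Both bounds are expressed through one Gaussian majorant K at time v, so the same K, of size
    v^(-1/2), will serve for every N. *)
Lemma cutoff_pairing_split :
  exists D0 : R -> R, [/\
    forall v, 0 < v < tau -> is_derive v 1
      (fun v => \int[mu]_(z in `[- N, N]) (W v z * cutoff N z * dipole v z)) (D0 v),
    forall v, 0 < v < tau -> {for v, continuous D0} &
    forall K v, 0 <= K -> 0 < v < tau ->
      (forall z, expR (A * `|z|) * (`|dipole v z| * (1 + z ^+ 2 / v)) <=
         K * heat (2 * v) z) ->
      `|- D0 v - \int[mu]_(z in `[- N, N]) (H v z * cutoff N z * dipole v z)| <=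
         12 * C / N ^+ 2 * K /\
      `|\int[mu]_(z in `[- N, N]) (H v z * cutoff N z * dipole v z)| <= C * K].
Proof.
exists D; split.
- by move=> v /is_derive_I[].
- by move=> v /is_derive_I[].
- move=> K v K0 vt hK; have /andP[v0 _] := vt.
  have v20 : 0 < 2 * v by rewrite mulr_gt0.
  have iH := int_of2 (fun z => @chH v z vt).
  have iE := int_of2 (fun z => @chE v z vt).
  split.
  + rewrite D_split// addrAC subrr add0r.
    apply: (norm_Rintegral_le_heat _ iE v20) => //.
      by rewrite !mulr_ge0 ?invr_ge0 ?sqr_ge0.
    move=> z; rewrite /= in_itv/= => zN; rewrite -mulrA.
    exact: hE_le.
  + apply: (norm_Rintegral_le_heat _ iH v20) => //; first by rewrite mulr_ge0.
    by move=> z; rewrite /= in_itv/= => zN; rewrite -mulrA; exact: hH_le.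
Qed.

(** Since q is minus the z-derivative of [heat] and the weight vanishes at the ends, integration by
    parts turns the pairing into a heat average of the z-derivative of W times the weight. It tends
    to the value at the origin, where the weight is 1 and has slope 0. *)
Lemma cutoff_pairing_at0 :
  \int[mu]_(z in `[- N, N]) (W v z * cutoff N z * dipole v z)
    @[v --> 0^'+] --> Wz 0 0.
Proof.
have Nn0 : N != 0 by rewrite gt_eqF.
have t0 := tau0; have d0 := dl0.
pose g v z := Wz v z * X z + W v z * Xz z.
have cg v z : - dl < v < tau -> continuous2_at g v z.
  move=> vt; apply: continuous2_atD.
    by apply: (@continuous2_atM _ Wz (fun _ => X)) => //; exact: cWz.
  by apply: (@continuous2_atM _ W (fun _ => Xz)) => //; exact: cW.
have z0t : - dl < 0 < tau by lra.
have gE : g 0 0 = Wz 0 0.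
  rewrite /g /X /Xz; have [-> ->] := @cutoff0 R N.
  by rewrite mulr1 mulr0 addr0.
have [M _ gM] : exists2 M, 0 <= M & forall v z, 0 <= v <= tau / 2 ->
    - N <= z <= N -> `|g v z| <= M.
  by apply: box_bounded => v z vt _; apply: cg; lra.
have t2 : 0 < tau / 2 by rewrite divr_gt0.
rewrite -gE; have := @heat_approximates_identity _ g (tau / 2) N M t2 N0.
have c1 v z : 0 < v < tau / 2 -> - N <= z <= N -> `|g v z| <= M.
  by move=> vt; apply: gM; lra.
have c2 v z : 0 < v < tau / 2 -> - N <= z <= N -> {for z, continuous (g v)}.
  by move=> vt _; apply/continuous2_at_snd/cg; lra.
move=> /(_ c1 c2 (cg _ _ z0t)); apply: cvg_trans; apply: near_eq_cvg.
near=> v.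
have v0 : 0 < v by near: v; exact: nbhs_right_gt.
have vtau : v < tau by near: v; exact: nbhs_right_lt.
have vt : 0 < v < tau by rewrite v0.
have ig : mu.-integrable `[- N, N] (EFin \o (fun z => g v z * heat v z)).
  apply: itv_continuous_integrable => z _; apply: cvgM.
    by apply/continuous2_at_snd/cg/sub.
  exact/continuous2_at_snd/continuous2_heat.
have cWX z : {for z, continuous (fun z => W v z * cutoff N z * dipole v z)}.
  apply: cvgM; last exact/continuous2_at_snd/continuous2_dipole.
  apply: cvgM; last exact: continuous_cutoff.
  exact/continuous2_at_snd/cW/sub.
have iWX : mu.-integrable `[- N, N]
    (EFin \o (fun z => W v z * cutoff N z * dipole v z)).
  by apply: itv_continuous_integrable => z _; exact: cWX.
apply/eqP; rewrite -subr_eq0 -RintegralB//; apply/eqP.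
pose B z := W v z * X z * heat v z.
transitivity (B N - B (- N)); first apply: Rintegral_FTC2; last first.
- rewrite /B; have [XN XNN] := cutoffN Nn0.
  by rewrite /X XN XNN; ring.
- move=> z _; have dw := dWz (v := v) z (sub vt).
  have dx := is_derive_cutoff z N0; have dh := is_derive_heat_z z v0.
  rewrite /B /X.
  by apply: is_derive_eq; rewrite /g /X /Xz /GRing.scale/=; ring.
- move=> z _; apply: cvgB; last exact: cWX.
  apply: cvgM.
    exact/continuous2_at_snd/cg/sub.
  exact/continuous2_at_snd/continuous2_heat.
- by rewrite -subr_gt0 opprK addr_gt0.
Unshelve. all: by end_near. Qed.

(** Near v = tau the kernel is bounded, so only W matters. It is assumed to tend to 0 pointwise in
    z; its growth bound allows dominated convergence, taken along sequences of times. *)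
Lemma cutoff_pairing_at_tau :
  \int[mu]_(z in `[- N, N]) (W v z * cutoff N z * dipole v z)
    @[v --> tau^'-] --> 0.
Proof.
have t0 := tau0.
have [M M0 dM] : exists2 M, 0 <= M & forall v z, tau / 2 <= v <= tau ->
    - N <= z <= N -> `|dipole v z| <= M.
  by apply: box_bounded => v z vt _; apply: continuous2_dipole; lra.
apply/cvg_at_leftP => u [ut utau].
have [n0 _ n0P] : \forall n \near \oo, tau / 2 < u n.
  by apply: (cvgr_gt tau utau); lra.
(* Dropping the first [n0] terms keeps all times above tau/2, where the bound M on the kernel
   holds. *)
pose w n := u (n + n0)%N.
have wt n : tau / 2 < w n < tau by rewrite ut andbT; apply: n0P; rewrite /= leq_addl.
have w0t n : 0 < w n < tau by have := wt n; lra.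
rewrite -(cvg_shiftn n0).
pose f_ n z := W (w n) z * cutoff N z * dipole (w n) z.
have cf n z : {for z, continuous (f_ n)}.
  have /andP[wn0 _] := w0t n.
  apply: cvgM; last exact/continuous2_at_snd/continuous2_dipole.
  apply: cvgM; last exact: continuous_cutoff.
  exact/continuous2_at_snd/cW/sub.
have mf n : measurable_fun (`[- N, N] : set R) (f_ n).
  have : mu.-integrable `[- N, N] (EFin \o f_ n).
    by apply: itv_continuous_integrable => z _; exact: cf.
  by move=> /integrableP[/measurable_EFinP].
have fM n z : `[- N, N]%classic z -> `|f_ n z| <= `|W (w n) z| * M.
  rewrite /= in_itv/= => zN; have /andP[X0 X1] := cutoff_le1 N0 zN.
  rewrite /f_ normrM; apply: ler_pM => //; last by apply: dM => //; have := wt n; lra.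
  by rewrite normrM (ger0_norm X0) ler_piMr.
have f0 z : `[- N, N]%classic z -> f_ n z @[n --> \oo] --> 0.
  move=> zN; have Wu : W (u n) z @[n --> \oo] --> 0.
    by have /cvg_at_leftP := W_tau z; apply.
  have Ww : `|W (w n) z| * M @[n --> \oo] --> 0.
    rewrite -[X in _ --> X](mul0r M); apply: cvgM; last exact: cvg_cst.
    rewrite -(normr0 R); apply: cvg_norm.
    by rewrite /w (cvg_shiftn n0 (fun n => W (u n) z)).
  apply: norm_cvg0; apply: (squeeze_cvgr _ (cvg_cst 0) Ww).
  by apply: nearW => n; rewrite normr_ge0 fM.
have fg n z : `[- N, N]%classic z -> `|f_ n z| <= C * expR (A * N) * M.
  move=> zN; apply: le_trans (fM n z zN) _; rewrite ler_wpM2r//.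
  apply: le_trans (W_le _ (w0t n)) _; rewrite ler_wpM2l// ler_expR ler_wpM2l//.
  by move: zN; rewrite /= in_itv/= ler_norml.
have ig : mu.-integrable `[- N, N] (EFin \o (fun _ : R => C * expR (A * N) * M)).
  by apply: itv_continuous_integrable => z _; exact: cvg_cst.
have [_] := Rintegral_dominated_cvg (measurable_itv _) mf f0 ig fg.
by rewrite Rintegral_cst// mul0r.
Qed.

End fixed_cutoff.
(** For each N the integral of the derivative of the pairing over a segment inside ]0, tau[ is a
    difference of endpoint values. Letting the segment grow together with N leaves a single limit:
    the endpoint values tend to W_z(0,0) and 0, while the integrands tend to J under a majorant of
    order v^(-1/2). *)
Lemma dipole_representation :
  (forall v, 0 < v < tau ->
    (fun n : nat => \int[mu]_(z in `[- n.+1%:R, n.+1%:R])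
       (H v z * cutoff n.+1%:R z * dipole v z)) @ \oo --> J v) ->
  mu.-integrable `]0, tau[ (EFin \o J) /\ \int[mu]_(v in `]0, tau[) J v = Wz 0 0.
Proof.
move=> HJ.
have [K K0 hK] := dipole_bound A0 tau0.
pose N (n : nat) : R := n.+1%:R.
have N0 n : 0 < N n by rewrite /N ltr0n.
have N1 n : 1 <= N n by rewrite /N ler1n.
pose I n v := \int[mu]_(z in `[- N n, N n]) (W v z * cutoff (N n) z * dipole v z).
pose JN n v := \int[mu]_(z in `[- N n, N n]) (H v z * cutoff (N n) z * dipole v z).
have [D /all_and3[dI cD DJ]] := choice (fun n => cutoff_pairing_split (N0 n)).
pose k v := K * (Num.sqrt v)^-1.
have k0 v : 0 <= k v by rewrite mulr_ge0// invr_ge0 sqrtr_ge0.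
have hk v : 0 < v < tau ->
    (forall z, expR (A * `|z|) * (`|dipole v z| * (1 + z ^+ 2 / v)) <=
       k v * heat (2 * v) z).
  by move=> /andP[v0 vt] z; apply: hK; rewrite v0 ltW.
have t20 : 0 < tau / 2 by rewrite divr_gt0.
have t2t : tau / 2 < tau by rewrite gtr_pMr// invf_lt1// ltr1n.
have i0 n : 0 < (N n)^-1 by rewrite invr_gt0.
(* The endpoint is chosen after N: close enough to 0 for the pairing to be within 1/N of its limit,
   below 1/N so that the segments exhaust ]0, tau[, and below tau/2 so that it precedes the other
   endpoint. *)
have near0 n : exists a, [/\ 0 < a, a < tau / 2, a < (N n)^-1 &
    `|Wz 0 0 - I n a| < (N n)^-1].
  have /cvgrPdist_lt/(_ _ (i0 n)) hI := cutoff_pairing_at0 (N0 n).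
  have : \forall a \near 0^'+, [/\ 0 < a, a < tau / 2, a < (N n)^-1 &
      `|Wz 0 0 - I n a| < (N n)^-1].
    by near=> a; split; near: a;
      [exact: nbhs_right_gt|exact: nbhs_right_lt|exact: nbhs_right_lt|].
  exact: filter_ex.
have neart n : exists b, [/\ b < tau, tau / 2 < b, tau - (N n)^-1 < b &
    `|0 - I n b| < (N n)^-1].
  have ti : tau - (N n)^-1 < tau by rewrite ltrBlDr ltrDl.
  have /cvgrPdist_lt/(_ _ (i0 n)) hI := cutoff_pairing_at_tau (N0 n).
  have : \forall b \near tau^'-, [/\ b < tau, tau / 2 < b, tau - (N n)^-1 < b &
      `|0 - I n b| < (N n)^-1].
    by near=> b; split; near: b;
      [exact: nbhs_left_lt|exact: nbhs_left_gt|exact: nbhs_left_gt|].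
  exact: filter_ex.
have [a aP] := choice near0; have [b bP] := choice neart.
have a0 n : 0 < a n by have [] := aP n.
have bt n : b n < tau by have [] := bP n.
have ab n : a n < b n.
  by have [_ at2 _ _] := aP n; have [_ tb2 _ _] := bP n; exact: lt_trans tb2.
have subab n x : a n <= x <= b n -> 0 < x < tau.
  by move=> /andP[ax xb]; rewrite (lt_le_trans (a0 n) ax) (le_lt_trans xb (bt n)).
have Vcvg : (N n)^-1 @[n --> \oo] --> 0 by exact: cvg_harmonic.
pose g n x := - D n x.
have cg n x : a n <= x <= b n -> {for x, continuous (g n)}.
  by move=> /subab xt; apply: cvgN; exact: cD.
pose f_ n := g n \_ `[a n, b n].
have mf n : measurable_fun (`]0, tau[ : set R) (f_ n).
  have : mu.-integrable `[a n, b n] (EFin \o g n).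
    by apply: itv_continuous_integrable => z; exact: cg.
  move=> /integrableP[/measurable_EFinP mg _].
  apply/measurable_restrict => //.
  by apply: measurable_funS mg.
have fJ v : `]0, tau[%classic v -> f_ n v @[n --> \oo] --> J v.
  rewrite /= in_itv/= => vt; have /andP[v0 vtau] := vt.
  have e0 : 12 * C * k v * (N n)^-1 @[n --> \oo] --> 0.
    rewrite -[X in _ --> X](mulr0 (12 * C * k v)).
    by apply: cvgM; [exact: cvg_cst|exact: Vcvg].
  have gJ : g n v - JN n v @[n --> \oo] --> 0.
    apply: norm_cvg0.
    apply: (@squeeze_cvgr _ _ _ _ (fun _ : nat => 0 : R) _ _ _ _ _ e0);
      last exact: cvg_cst.
    apply: nearW => n; rewrite /= normr_ge0/=.
    have [le1 _] := DJ n (k v) v (k0 v) vt (hk v vt).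
    apply: le_trans le1 _.
    have -> : 12 * C / N n ^+ 2 * k v = 12 * C * k v * (N n)^-1 * (N n)^-1.
      by field; rewrite gt_eqF.
    rewrite ler_piMr ?invf_le1//.
    by rewrite mulr_ge0 ?(ltW (i0 n))// mulr_ge0// mulr_ge0.
  have gJ' : g n v @[n --> \oo] --> J v.
    have gJH := cvgD gJ (HJ _ vt); rewrite add0r in gJH.
    have -> : g^~ v = (fun n => g n v - JN n v) \+ JN^~ v.
      by apply/funext => n /=; rewrite subrK.
    exact: gJH.
  apply: cvg_trans gJ'; apply: near_eq_cvg.
  have Nv : \forall n \near \oo, (N n)^-1 < v by exact: (cvgr_lt 0 Vcvg).
  have Ntv : \forall n \near \oo, (N n)^-1 < tau - v.
    by apply: (cvgr_lt 0 Vcvg); rewrite subr_gt0.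
  near=> n; rewrite /f_ patchT// inE/= in_itv/=.
  apply/andP; split.
    have [_ _ aN _] := aP n; apply/ltW/(lt_trans aN).
    by near: n.
  have [_ _ bN _] := bP n; apply/ltW; apply: lt_trans bN.
  rewrite ltrBrDl -ltrBrDr.
  by near: n.
(* 13 = 12 + 1: the weight error, where N >= 1, plus the pairing with H. *)
have fg n v : `]0, tau[%classic v -> `|f_ n v| <= 13 * C * K * (Num.sqrt v)^-1.
  rewrite /= in_itv/= => vt; rewrite /f_ /patch.
  have k13 : 13 * C * K * (Num.sqrt v)^-1 = 13 * C * k v by rewrite /k mulrA.
  rewrite k13; case: ifP => _; last by rewrite normr0 mulr_ge0// mulr_ge0.
  have [le1 le2] := DJ n (k v) v (k0 v) vt (hk v vt).
  have -> : g n v = (- D n v - JN n v) + JN n v by rewrite subrK.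
  apply: le_trans (ler_normD _ _) _; apply: le_trans (lerD le1 le2) _.
  have -> : 13 * C * k v = 12 * C * k v + C * k v by ring.
  rewrite lerD2r; have -> : 12 * C / N n ^+ 2 * k v = 12 * C * k v / N n ^+ 2 by ring.
  rewrite ler_piMr//; first by rewrite mulr_ge0// mulr_ge0.
  by rewrite invf_le1 ?exprn_gt0// exprn_ege1.
have ig : mu.-integrable `]0, tau[
    (EFin \o (fun v => 13 * C * K * (Num.sqrt v)^-1)).
  exact: (integrableZl _ (13 * C * K) (integrable_inv_sqrt tau0)).
have [iJ cvJ] := Rintegral_dominated_cvg (measurable_itv _) mf fJ ig fg.
have intf n : \int[mu]_(v in `]0, tau[) f_ n v = I n (a n) - I n (b n).
  rewrite -Rintegral_mkcondr.
  have -> : `]0, tau[ `&` `[a n, b n] = `[a n, b n]%classic.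
    apply/setIidPr => x; rewrite /= !in_itv/=; exact: subab.
  have -> : I n (a n) - I n (b n) = (- I n (b n)) - (- I n (a n)) by rewrite opprK addrC.
  apply: (@Rintegral_FTC2 _ (g n) (fun x => - I n x)) => //; first exact: cg.
  by move=> x /subab xt; have dx := dI n x xt; exact: is_deriveN.
have cvW : \int[mu]_(v in `]0, tau[) f_ n v @[n --> \oo] --> Wz 0 0.
  apply/cvgrPdist_le => e e0.
  have e2 : 0 < e / 2 by rewrite divr_gt0.
  have Ne2 : \forall n \near \oo, (N n)^-1 < e / 2 by exact: (cvgr_lt 0 Vcvg).
  near=> n; rewrite intf.
  have [_ _ _ Ia] := aP n; have [_ _ _] := bP n; rewrite sub0r normrN => Ib.
  have Ne : (N n)^-1 < e / 2 by near: n.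
  have -> : Wz 0 0 - (I n (a n) - I n (b n)) = Wz 0 0 - I n (a n) + I n (b n).
    by rewrite opprB [I n (b n) - _]addrC addrA.
  apply: le_trans (ler_normD _ _) _.
  have -> : e = e / 2 + e / 2 by rewrite -splitr.
  by apply: lerD; apply/ltW; [apply: lt_trans Ne|apply: lt_trans Ne].
by split => //; exact: (cvg_unique _ cvJ cvW).
Unshelve. all: by end_near. Qed.

End dipole_representation.

(** * Logarithmic change of variables from ]0, +oo[ to the line *)

Section log_substitution.
Context {R : realType}.
Notation mu := (@lebesgue_measure R).
Context (c s : R) (c0 : 0 < c) (s0 : 0 < s).

Let X (z : R) := c * expR (s * z).

Let X0 z : 0 < X z. Proof. by rewrite mulr_gt0// expR_gt0. Qed.

Let dX (z : R) : is_derive z 1 X (s * X z).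
Proof.
have dl : is_derive z 1 (fun x : R => s * x) s.
  by apply: is_derive_eq; rewrite /GRing.scale/=; ring.
have de := @is_derive1_comp _ expR _ _ _ _ (is_derive_expR _) dl.
rewrite /comp in de; rewrite /X.
by apply: is_derive_eq; rewrite /GRing.scale/=; ring.
Qed.

Let cX : continuous X.
Proof.
move=> z; apply/differentiable_continuous/derivable1_diffP.
by have d := dX z; exact: ex_derive.
Qed.

Let X'E : derive1 X = (fun z => s * X z).
Proof. by apply/funext => z; rewrite derive1E; have d := dX z; rewrite derive_val. Qed.

Let cX' : continuous (derive1 X).
Proof. by rewrite X'E => z; apply: cvgM; [exact: cvg_cst|exact: cX]. Qed.

Let incrX (x y : R) : x < y -> X x < X y.
Proof. by move=> xy; rewrite ltr_pM2l// ltr_expR ltr_pM2l. Qed.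

Let compact_substitution (g : R -> R) (a b : R) : a <= b ->
  (forall x, 0 < x -> {for x, continuous g}) ->
  (\int[mu]_(x in `[X a, X b]) (g x)%:E =
   \int[mu]_(z in `[a, b]) (g (X z) * (s * X z))%:E)%E.
Proof.
move=> ab cg; rewrite (@integration_by_substitution_increasing _ X g a b ab).
- by rewrite X'E.
- by move=> x y _ _; exact: incrX.
- by move=> x _; exact: cX'.
- by apply/cvg_ex; exists (derive1 X a); exact/cvg_at_right_filter/cX'.
- by apply/cvg_ex; exists (derive1 X b); exact/cvg_at_left_filter/cX'.
- split; last 2 first.
    exact/cvg_at_right_filter/cX.
    exact/cvg_at_left_filter/cX.
  by move=> x _; have d := dX x; exact: ex_derive.
- apply: itv_within_continuous => x /andP[ax _]; apply: cg.
  exact: lt_le_trans ax.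
Qed.

(** Both domains are exhausted by corresponding segments, [-n, n] and its image; monotone
    convergence identifies the limits, finite or not. *)
Let ge0_log_substitution (g : R -> R) :
  (forall x, 0 < x -> {for x, continuous g}) -> (forall x, 0 <= g x) ->
  (\int[mu]_(x in `]0%R, +oo[) (g x)%:E =
   \int[mu]_z (g (X z) * (s * X z))%:E)%E.
Proof.
move=> cg g0.
pose D n : set R := `[X (- n%:R), X n%:R]%classic.
pose E n : set R := `[- n%:R, n%:R]%classic.
have EU : [set: R] = \bigcup_n E n.
  apply/seteqP; split => // x _.
  exists (Num.bound `|x|) => //; rewrite /E /= in_itv/= -ler_norml.
  by apply/ltW; exact: archi_boundP.
have DU : `]0, +oo[%classic = \bigcup_n D n.
  apply/seteqP; split => [x|x [n _]]; rewrite /D /= !in_itv/= ?andbT; last first.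
    by move=> /andP[h _]; exact: lt_le_trans h.
  move=> x0; pose z := s^-1 * ln (x / c).
  have xE : x = X z.
    rewrite /X /z mulVKf ?gt_eqF// lnK ?posrE ?divr_gt0//.
    by rewrite mulrC divfK// gt_eqF.
  have : [set: R] z by []. 
  rewrite EU => -[n _]; rewrite /E /= in_itv/= => /andP[nz zn].
  exists n => //; rewrite /= in_itv/= xE.
  by rewrite !ler_pM2l// !ler_expR !ler_pM2l// nz zn.
have cgX z : {for z, continuous (fun z => g (X z) * (s * X z))}.
  apply: cvgM; last by apply: cvgM; [exact: cvg_cst|exact: cX].
  have h : {for z, continuous (g \o X)}.
    by apply: continuous_comp; [exact: cX|exact/cg/X0].
  exact: h.
have mgX : measurable_fun [set: R] (fun z => (g (X z) * (s * X z))%:E).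
  by apply/measurable_EFinP; exact: continuous_measurable_fun.
have mg : measurable_fun (`]0, +oo[ : set R) (fun x => (g x)%:E).
  apply/measurable_EFinP; apply: open_continuous_measurable_fun.
    exact: interval_open.
  by move=> x /set_mem/=; rewrite in_itv/= andbT; exact: cg.
have cvD : (\int[mu]_(x in D n) (g x)%:E @[n --> \oo] -->
    \int[mu]_(x in `]0%R, +oo[) (g x)%:E)%E.
  rewrite DU; apply: ge0_nondecreasing_set_cvg_integral => //.
  - move=> n m nm; apply/subsetPset => x; rewrite /D /= !in_itv/=.
    have Xn : X n%:R <= X m%:R by rewrite ler_pM2l// ler_expR ler_pM2l// ler_nat.
    have XNn : X (- m%:R) <= X (- n%:R).
      by rewrite ler_pM2l// ler_expR ler_pM2l// lerN2 ler_nat.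
    by move=> /andP[h1 h2]; rewrite (le_trans XNn h1) (le_trans h2 Xn).
  - by move=> i; exact: measurable_itv.
  - move=> i; apply: measurable_funS mg => //.
    by rewrite DU; exact: bigcup_sup.
  - by move=> i x _; rewrite lee_fin.
have cvE : (\int[mu]_(z in E n) (g (X z) * (s * X z))%:E @[n --> \oo] -->
    \int[mu]_z (g (X z) * (s * X z))%:E)%E.
  rewrite EU; apply: ge0_nondecreasing_set_cvg_integral => //.
  - move=> n m nm; apply/subsetPset => x; rewrite /E /= !in_itv/=.
    have nm' : n%:R <= m%:R :> R by rewrite ler_nat.
    have nmN : - m%:R <= - n%:R :> R by rewrite lerN2.
    by move=> /andP[h1 h2]; rewrite (le_trans nmN h1) (le_trans h2 nm').
  - by move=> i; exact: measurable_itv.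
  - by move=> i; apply: measurable_funS mgX.
  - by move=> i x _; rewrite lee_fin mulr_ge0// mulr_ge0// ltW.
have DE n : (\int[mu]_(x in D n) (g x)%:E =
    \int[mu]_(z in E n) (g (X z) * (s * X z))%:E)%E.
  by apply: compact_substitution => //; apply: (@le_trans _ _ 0); rewrite ?oppr_le0.
move: cvD; under eq_fun do rewrite DE.
by move=> cvD; exact: (cvg_unique _ cvD cvE).
Qed.

(** No integrability is asked: positive and negative parts are substituted separately as extended
    integrals, and [fine] is applied to equal values. *)
Lemma log_substitution (g : R -> R) :
  (forall x, 0 < x -> {for x, continuous g}) ->
  \int[mu]_(x in `]0, +oo[) g x =
  \int[mu]_z (g (c * expR (s * z)) * (s * (c * expR (s * z)))).
Proof.
move=> cg; rewrite /Rintegral; congr fine.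
pose gp x := Num.max (g x) 0; pose gn x := Num.max (- g x) 0.
have cgp x : 0 < x -> {for x, continuous gp}.
  by move=> x0; apply: continuous_max; [exact: cg|exact: cvg_cst].
have cgn x : 0 < x -> {for x, continuous gn}.
  move=> x0; apply: continuous_max; last exact: cvg_cst.
  by apply: cvgN; exact: cg.
have gp0 x : 0 <= gp x by rewrite le_max lexx orbT.
have gn0 x : 0 <= gn x by rewrite le_max lexx orbT.
have sX z : 0 <= s * X z by rewrite mulr_ge0// ltW.
rewrite integralE [RHS]integralE; congr (_ - _)%E.
- transitivity (\int[mu]_(x in `]0%R, +oo[) (gp x)%:E)%E.
    by apply: eq_integral => x _; rewrite funeposE /= EFin_max.
  rewrite ge0_log_substitution//; apply: eq_integral => z _.
  by rewrite funeposE /= -EFin_max /gp maxr_pMl// mul0r.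
- transitivity (\int[mu]_(x in `]0%R, +oo[) (gn x)%:E)%E.
    by apply: eq_integral => x _; rewrite funenegE /= EFin_max EFinN.
  rewrite ge0_log_substitution//; apply: eq_integral => z _.
  by rewrite funenegE /= -EFin_max /gn maxr_pMl// mul0r mulNr.
Qed.

End log_substitution.

(** * Mean value slopes and a chain rule in three variables *)

Section chain_rule.
Context {R : realType}.

Lemma slope_between (h h' : R -> R) (p q : R) : p != q ->
  (forall t : R, `|t - p| <= `|q - p| -> is_derive t 1 h (h' t)) ->
  exists2 t, `|t - p| <= `|q - p| & (h q - h p) / (q - p) = h' t.
Proof.
move=> pq dh.
have step (x y : R) : x < y -> (forall t : R, x <= t <= y -> is_derive t 1 h (h' t)) ->
    exists2 t, x <= t <= y & (h y - h x) / (y - x) = h' t.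
  move=> xy dxy.
  have [| |t] := @MVT _ h h' x y xy.
  - by move=> t; rewrite in_itv/= => /andP[xt ty]; apply: dxy; rewrite !ltW.
  - apply: derivable_within_continuous => t; rewrite in_itv/= => txy.
    by have d := dxy t txy; exact: ex_derive.
  - rewrite in_itv/= => /andP[xt ty] ->; exists t; first by rewrite !ltW.
    by rewrite mulfK// subr_eq0 gt_eqF.
have [pq'|qp|pqE] := ltgtP p q; last by rewrite pqE eqxx in pq.
- have [t pt|t /andP[pt tq] tE] := step _ _ pq'.
    by apply: dh; rewrite !ger0_norm ?subr_ge0; lra.
  by exists t => //; rewrite !ger0_norm ?subr_ge0//; lra.
- have [t pt|t /andP[qt tp] tE] := step _ _ qp.
    by apply: dh; rewrite !ler0_norm ?subr_le0; lra.
  exists t; first by rewrite !ler0_norm ?subr_le0//; lra.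
  by rewrite -tE -[h q - _]opprB -[q - _]opprB invrN mulrNN.
Qed.

(** A Caratheodory slope for a function that itself moves with x: by the mean value theorem the
    quotient is [h' x] at an intermediate point, hence close to L near (v, a v). *)
Lemma continuous_slope (h h' : R -> R -> R) (a : R -> R) (v L : R) :
  {for v, continuous a} ->
  (forall e, 0 < e -> exists2 d, 0 < d & forall x t : R, `|x - v| < d ->
    `|t - a v| < d -> is_derive t 1 (h x) (h' x t) /\ `|h' x t - L| < e) ->
  exists g : R -> R,
    [/\ forall x, h x (a x) - h x (a v) = g x * (a x - a v),
        {for v, continuous g} & g v = L].
Proof.
move=> ca hd.
(* Where the increment of [a] vanishes there is no quotient; putting L in its place keeps g
   continuous at v. *)
pose g x := if a x == a v then L else (h x (a x) - h x (a v)) / (a x - a v).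
have gv : g v = L by rewrite /g eqxx.
exists g; split => //.
- move=> x; rewrite /g; case: eqVneq => [->|axv]; first by rewrite !subrr mulr0.
  by rewrite divfK// subr_eq0.
- apply/cvgrPdist_lt => e e0; rewrite gv.
  have [d d0 dP] := hd e e0.
  have cad : \forall x \near v, `|a v - a x| < d by move/cvgrPdist_lt : ca => /(_ _ d0).
  near=> x.
  have xv : `|x - v| < d.
    by near: x; apply/nbhs_ballP; exists d => // x; rewrite /ball/= distrC.
  have axv : `|a x - a v| < d by rewrite distrC; near: x.
  rewrite /g; case: eqVneq => [_|axvn]; first by rewrite subrr normr0.
  have vx : a v != a x by rewrite eq_sym.
  have dh t : `|t - a v| <= `|a x - a v| -> is_derive t 1 (h x) (h' x t).
    by move=> ht; exact: (dP x t xv (le_lt_trans ht axv)).1.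
  have [t ht ->] := slope_between vx dh.
  by rewrite distrC; exact: (dP x t xv (le_lt_trans ht axv)).2.
Unshelve. all: by end_near. Qed.

Definition continuous3_at (f : R -> R -> R -> R) (t s y : R) : Prop :=
  {for (t, s, y), continuous (fun q : R * R * R => f q.1.1 q.1.2 q.2)}.

Lemma continuous3_at_dist (f : R -> R -> R -> R) (t s y e : R) :
  continuous3_at f t s y -> 0 < e ->
  exists2 d, 0 < d & forall t' s' y', `|t' - t| < d -> `|s' - s| < d ->
    `|y' - y| < d -> `|f t' s' y' - f t s y| < e.
Proof.
move=> /cvgrPdist_lt cf e0; have := cf _ e0.
move=> /nbhs_ballP[d /= d0 df]; exists d => // t' s' y' tt ss yy.
rewrite distrC; apply: (df (t', s', y')).
by split; [split|]; rewrite /= /ball/= distrC.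
Qed.

(** The increment is split by moving one coordinate at a time. Each piece is a slope times an
    increment of [a], [b] or [c], so the sum is again a Caratheodory decomposition and no remainder
    has to be estimated. Along the characteristic t, s and y all move at once. *)
Lemma is_derive_comp3 (f ft fs fy : R -> R -> R -> R) (a b c : R -> R)
    (v a' b' c' d0 : R) :
  0 < d0 ->
  (forall t s y : R, `|t - a v| < d0 -> `|s - b v| < d0 -> `|y - c v| < d0 ->
    [/\ is_derive t 1 (fun x => f x s y) (ft t s y),
        is_derive s 1 (fun x => f t x y) (fs t s y) &
        is_derive y 1 (f t s) (fy t s y)]) ->
  continuous3_at ft (a v) (b v) (c v) ->
  continuous3_at fs (a v) (b v) (c v) ->
  continuous3_at fy (a v) (b v) (c v) ->
  is_derive v 1 a a' -> is_derive v 1 b b' -> is_derive v 1 c c' ->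
  is_derive v 1 (fun x => f (a x) (b x) (c x))
    (ft (a v) (b v) (c v) * a' + fs (a v) (b v) (c v) * b' +
     fy (a v) (b v) (c v) * c').
Proof.
move=> d00 df cft cfs cfy da db dc.
have cont (h : R -> R) l : is_derive v 1 h l -> {for v, continuous h}.
  by move=> dh; apply/differentiable_continuous/derivable1_diffP; exact: ex_derive.
have ca := cont _ _ da; have cb := cont _ _ db; have cc := cont _ _ dc.
have near1 (h : R -> R) d : {for v, continuous h} -> 0 < d ->
    exists2 d', 0 < d' & forall x, `|x - v| < d' -> `|h x - h v| < d.
  move=> /cvgrPdist_lt ch d_gt0; have /nbhs_ballP[d' /= d'0 dh] := ch _ d_gt0.
  by exists d' => // x xv; rewrite distrC; apply: dh; rewrite /ball/= distrC.
have z0 d : 0 < d -> forall x : R, `|x - x| < d by move=> ? x; rewrite subrr normr0.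
have [ga [gaE cga gav]] : exists g : R -> R,
    [/\ forall x, f (a x) (b x) (c x) - f (a v) (b x) (c x) = g x * (a x - a v),
        {for v, continuous g} & g v = ft (a v) (b v) (c v)].
  apply: (@continuous_slope (fun x t => f t (b x) (c x))
            (fun x t => ft t (b x) (c x)) a) => // e e0.
  have [d1 d10 d1P] := continuous3_at_dist cft e0.
  pose d2 := Num.min d0 d1.
  have d20 : 0 < d2 by rewrite lt_min d00.
  have [d3 d30 d3P] := near1 b d2 cb d20; have [d4 d40 d4P] := near1 c d2 cc d20.
  exists (Num.min d2 (Num.min d3 d4)); first by rewrite lt_min d20 lt_min d30.
  move=> x t; rewrite lt_min => /andP[_]; rewrite lt_min => /andP[xd3 xd4].
  rewrite lt_min => /andP[td2 _].
  have := d4P _ xd4; have := d3P _ xd3; move: td2.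
  rewrite !lt_min => /andP[? ?] /andP[? ?] /andP[? ?]; split; last exact: d1P.
  by have [] := df t (b x) (c x).
have [gb [gbE cgb gbv]] : exists g : R -> R,
    [/\ forall x, f (a v) (b x) (c x) - f (a v) (b v) (c x) = g x * (b x - b v),
        {for v, continuous g} & g v = fs (a v) (b v) (c v)].
  apply: (@continuous_slope (fun x t => f (a v) t (c x))
            (fun x t => fs (a v) t (c x)) b) => // e e0.
  have [d1 d10 d1P] := continuous3_at_dist cfs e0.
  pose d2 := Num.min d0 d1.
  have d20 : 0 < d2 by rewrite lt_min d00.
  have [d4 d40 d4P] := near1 c d2 cc d20.
  exists (Num.min d2 d4); first by rewrite lt_min d20.
  move=> x t; rewrite lt_min => /andP[_ xd4]; rewrite lt_min => /andP[td2 _].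
  have := d4P _ xd4; move: td2.
  rewrite !lt_min => /andP[? ?] /andP[? ?]; split.
    by have [] := df (a v) t (c x); rewrite ?z0.
  by apply: d1P; rewrite ?z0.
have [gc [gcE cgc gcv]] : exists g : R -> R,
    [/\ forall x, f (a v) (b v) (c x) - f (a v) (b v) (c v) = g x * (c x - c v),
        {for v, continuous g} & g v = fy (a v) (b v) (c v)].
  apply: (@continuous_slope (fun x t => f (a v) (b v) t)
            (fun x t => fy (a v) (b v) t) c) => // e e0.
  have [d1 d10 d1P] := continuous3_at_dist cfy e0.
  exists (Num.min d0 d1); first by rewrite lt_min d00.
  move=> x t _; rewrite lt_min => /andP[? ?]; split.
    by have [] := df (a v) (b v) t; rewrite ?z0.
  by apply: d1P; rewrite ?z0.
have [ha [haE cha hav]] := (is_derive1_caratheodory _ _ _).1 da.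
have [hb [hbE chb hbv]] := (is_derive1_caratheodory _ _ _).1 db.
have [hc [hcE chc hcv]] := (is_derive1_caratheodory _ _ _).1 dc.
apply/is_derive1_caratheodory.
exists (fun x => ga x * ha x + gb x * hb x + gc x * hc x); split.
- move=> x; rewrite !mulrDl -!mulrA -haE -hbE -hcE -gaE -gbE -gcE; ring.
- by apply: cvgD; [apply: cvgD|]; apply: cvgM.
- by rewrite gav gbv gcv hav hbv hcv.
Qed.

End chain_rule.

(** * Transition rates *)

Section transition_rates.
Context {R : realType} (k : nat) (lam : 'I_k -> 'I_k -> R -> R).
Notation mu := (@lebesgue_measure R).

(** Close to y the difference quotient is within 1 of its limit l, so g varies by at most |l| + 1
    times the distance; clamping makes every argument admissible. *)
Lemma differentiable_on_nonneg_continuous (g : R -> R) :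
  differentiable_on_nonneg g -> continuous (fun y : R => g (Num.max y 0)).
Proof.
move=> dg x; set y := Num.max x 0.
have y0 : 0 <= y by rewrite le_max lexx orbT.
have cmax : (Num.max x' 0 @[x' --> x] --> y).
  exact: (@continuous_max _ _ id (cst 0) x cvg_id (cvg_cst _)).
have /cvg_ex[l gl] := dg y y0.
apply/cvgrPdist_lt => e e0.
move/cvgrPdist_lt : gl => /(_ _ ltr01); rewrite near_withinE.
rewrite /dnbhs near_withinE => /nbhs_ballP[d /= d0 dP].
have l1 : 0 < `|l| + 1 by rewrite ltr_wpDl.
have c0 : 0 < e / (`|l| + 1) by rewrite divr_gt0.
move/cvgrPdist_lt : cmax => cmax.
near=> x'.
have yd : `|y - Num.max x' 0| < d by near: x'; exact: cmax.
have yc : `|y - Num.max x' 0| < e / (`|l| + 1) by near: x'; exact: cmax.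
set y' := Num.max x' 0 in yd yc *.
have y'0 : 0 <= y' by rewrite le_max lexx orbT.
have [->|yy'] := eqVneq y' y; first by rewrite subrr normr0.
have yy0 : y' - y != 0 by rewrite subr_eq0.
have := dP (y' - y); rewrite /ball/= sub0r normrN distrC => /(_ yd yy0).
rewrite subrKC => /(_ y'0) dl.
have slope : `|(y' - y)^-1 * (g y' - g y)| <= `|l| + 1.
  have -> : (y' - y)^-1 * (g y' - g y) = l - (l - (y' - y)^-1 * (g y' - g y)).
    by rewrite opprB addrCA subrr addr0.
  by apply: le_trans (ler_normB _ _) _; rewrite lerD2l ltW.
have -> : g y - g y' = - ((y' - y)^-1 * (g y' - g y) * (y' - y)).
  by rewrite mulrAC mulVf// mul1r opprB.
rewrite normrN normrM [`|y' - y|]distrC.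
apply: le_lt_trans (ler_wpM2r (normr_ge0 _) slope) _.
by rewrite mulrC -ltr_pdivlMr.
Unshelve. all: by end_near. Qed.

Hypothesis lam_gt0 : forall (i j : 'I_k) (y : R), i != j -> 0 <= y -> 0 < lam i j y.
Hypothesis lam_diff : forall i j : 'I_k, i != j -> differentiable_on_nonneg (lam i j).

(* Clamping y at 0 turns the one-sided regularity at y = 0 into continuity on
   the whole line. *)
Definition total_rate (i : 'I_k) (y : R) : R :=
  \sum_(j < k | j != i) lam i j (Num.max y 0).

Lemma continuous_total_rate (i : 'I_k) : continuous (total_rate i).
Proof.
move=> y; apply: cvg_big => [|j ji]; first exact: add_continuous.
by apply: differentiable_on_nonneg_continuous; apply: lam_diff; rewrite eq_sym.
Qed.

Lemma total_rate_ge0 (i : 'I_k) (y : R) : 0 <= total_rate i y.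
Proof.
apply: sumr_ge0 => j ji; apply/ltW/lam_gt0; first by rewrite eq_sym.
by rewrite le_max lexx orbT.
Qed.

Lemma total_rateE (i : 'I_k) (y : R) : 0 <= y ->
  total_rate i y = \sum_(j < k | j != i) lam i j y.
Proof. by move=> y0; apply: eq_bigr => j _; rewrite max_l. Qed.

Lemma norm_lam_diag (i : 'I_k) (y : R) : 0 <= y ->
  `|lam_diag lam i y| = total_rate i y.
Proof.
move=> y0; rewrite /lam_diag normrN -total_rateE// ger0_norm//.
exact: total_rate_ge0.
Qed.

Lemma is_derive_Lam (i : 'I_k) (y : R) : 0 < y ->
  is_derive y 1 (Lam lam i) (total_rate i y).
Proof.
move=> y0.
have LE : Lam lam i = (fun u : R => \int[mu]_(v in `[0, u]) total_rate i v).
  apply/funext => u; apply: eq_Rintegral => v /set_mem/=.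
  by rewrite in_itv/= => /andP[v0 _]; exact: norm_lam_diag.
have yy : y < y + 1 by rewrite ltrDl.
have it : mu.-integrable `[0, y + 1] (EFin \o total_rate i).
  by apply: itv_continuous_integrable => v _; exact: continuous_total_rate.
have [dF FE] := continuous_FTC1_closed yy it y0 (@continuous_total_rate i y).
by rewrite LE; apply: DeriveDef; [exact: dF|rewrite -derive1E; exact: FE].
Qed.

Definition survival (i : 'I_k) (y : R) : R := expR (- Lam lam i y).

Lemma survival_gt0 (i : 'I_k) (y : R) : 0 < survival i y.
Proof. exact: expR_gt0. Qed.

Lemma survivalE (i : 'I_k) (y : R) : 1 - F lam y i = survival i y.
Proof. by rewrite /F opprB addrC subrK. Qed.

Lemma is_derive_survival (i : 'I_k) (y : R) : 0 < y ->
  is_derive y 1 (survival i) (- (total_rate i y * survival i y)).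
Proof.
move=> y0; have dL := is_derive_Lam i y0.
have de := @is_derive1_comp _ expR _ _ _ _ (is_derive_expR _) (is_deriveN dL).
rewrite /comp in de; rewrite /survival.
by apply: is_derive_eq de _; rewrite mulrN mulrC.
Qed.

Lemma continuous_survival (i : 'I_k) (y : R) : 0 < y ->
  {for y, continuous (survival i)}.
Proof.
move=> y0; apply/differentiable_continuous/derivable1_diffP.
by have d := is_derive_survival i y0; exact: ex_derive.
Qed.

(** The density [f] is the total rate times [survival], and the total rate cancels against the
    denominator of [p]; it is nonzero because it contains the positive rate from i to j. *)
Lemma p_density (i j : 'I_k) (y : R) : j != i -> 0 < y ->
  f lam y i * p lam i j y = survival i y * lam i j y.
Proof.
move=> ji y0.
have fE : f lam y i = total_rate i y * survival i y.
  have FE : (fun x : R => F lam x i) = (fun x => 1 - survival i x).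
    by apply/funext => x; rewrite -survivalE opprB addrC subrK.
  have dS := is_derive_survival i y0.
  have d1 : is_derive y 1 (fun x => 1 - survival i x)
      (total_rate i y * survival i y).
    by apply: is_derive_eq; ring.
  by rewrite /f FE derive1E derive_val.
have t0 : total_rate i y != 0.
  rewrite total_rateE ?ltW// gt_eqF// (bigD1 j)//= ltr_wpDr//.
    by apply: sumr_ge0 => l /andP[li _]; apply/ltW/lam_gt0; rewrite 1?eq_sym// ltW.
  by apply: lam_gt0; rewrite 1?eq_sym// ltW.
rewrite fE /p (negbTE ji) norm_lam_diag ?ltW//.
by move: (survival i y) => S; field.
Qed.

End transition_rates.

(** * Reduction to the heat equation *)

Section constant_coefficients.
Context {R : realType}.
Notation mu := (@lebesgue_measure R).

Lemma dom_open (T t s y : R) : dom T (t, s, y) ->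
  exists2 d, 0 < d & forall t' s' y' : R,
    `|t' - t| < d -> `|s' - s| < d -> `|y' - y| < d -> dom T (t', s', y').
Proof.
move=> [/= t0T s0 y0T y0t].
(* Half of t - y, since t and y may move towards each other. *)
pose d := Num.min (Num.min (T - t) s) (Num.min y ((t - y) / 2)).
have d0 : 0 < d by rewrite !lt_min; lra.
exists d => // t' s' y'; rewrite !ltr_distl.
have : d <= T - t by rewrite /d !ge_min lexx.
have : d <= s by rewrite /d !ge_min lexx !orbT.
have : d <= y by rewrite /d !ge_min lexx !orbT.
have : d <= (t - y) / 2 by rewrite /d !ge_min lexx !orbT.
move: d0; clearbody d => *; split => /=; lra.
Qed.

Lemma continuous2_at_comp3 (f : R -> R -> R -> R) (a b c : R -> R -> R) (v z : R) :
  continuous2_at a v z -> continuous2_at b v z -> continuous2_at c v z ->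
  continuous3_at f (a v z) (b v z) (c v z) ->
  continuous2_at (fun v z => f (a v z) (b v z) (c v z)) v z.
Proof.
move=> ca cb cc cf.
have h : (a p.1 p.2, b p.1 p.2, c p.1 p.2) @[p --> (v, z)] -->
    (a v z, b v z, c v z).
  apply: (@cvg_pair _ _ _ _ (nbhs (a v z, b v z)) (nbhs (c v z))) => //.
  exact: (@cvg_pair _ _ _ _ (nbhs (a v z)) (nbhs (b v z))).
exact: (cvg_comp _ (fun q : R * R * R => f q.1.1 q.1.2 q.2) h cf).
Qed.

Context (T t0 s0 y0 r sg C : R) (f ft fs fss fy h : R -> R -> R -> R) (J : R -> R).
Hypotheses (sg0 : 0 < sg) (dom0 : dom T (t0, s0, y0)).
Hypothesis df : forall t s y : R, dom T (t, s, y) ->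
  [/\ is_derive t 1 (fun x => f x s y) (ft t s y),
      is_derive s 1 (fun x => f t x y) (fs t s y),
      is_derive s 1 (fun x => fs t x y) (fss t s y) &
      is_derive y 1 (f t s) (fy t s y)].
Hypothesis cf : forall t s y : R, dom T (t, s, y) -> continuous3_at f t s y.
Hypothesis cft : forall t s y : R, dom T (t, s, y) -> continuous3_at ft t s y.
Hypothesis cfs : forall t s y : R, dom T (t, s, y) -> continuous3_at fs t s y.
Hypothesis cfss : forall t s y : R, dom T (t, s, y) -> continuous3_at fss t s y.
Hypothesis cfy : forall t s y : R, dom T (t, s, y) -> continuous3_at fy t s y.
Hypothesis ch : forall t s y : R, dom T (t, s, y) -> continuous3_at h t s y.
Hypothesis pde : forall t s y : R, dom T (t, s, y) ->
  ft t s y + fy t s y + r * s * fs t s y + 2^-1 * sg ^+ 2 * s ^+ 2 * fss t s y =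
  r * f t s y - h t s y.
Hypothesis f_le : forall t s y : R, dom T (t, s, y) -> `|f t s y| <= C * (1 + s).
Hypothesis h_le : forall t s y : R, dom T (t, s, y) -> `|h t s y| <= C * (1 + s).

(** In the variable log s the Black-Scholes operator has constant coefficients, with drift m and
    variance sg^2. Moving with the drift and scaling by sg leaves half the second z-derivative. *)
Let m := r - sg ^+ 2 / 2.
Let X (v z : R) := s0 * expR (m * v + sg * z).
Let tau := T - t0.

Let along (g : R -> R -> R -> R) (v z : R) := g (t0 + v) (X v z) (y0 + v).

(** Negative v is allowed down to - y0: since y0 < t0, the characteristic stays in D for that long
    before it reaches the base point. *)
Let dom_along (v z : R) : - y0 < v < tau -> dom T (t0 + v, X v z, y0 + v).
Proof.
have [/= ? s00 ? ?] := dom0; rewrite /tau => vt.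
by split => /=; rewrite ?mulr_gt0 ?expR_gt0//; lra.
Qed.

Let X0 (v z : R) : 0 < X v z.
Proof. by have [_ /= s00 _ _] := dom0; rewrite mulr_gt0 ?expR_gt0. Qed.

Let dXz (v z : R) : is_derive z 1 (X v) (sg * X v z).
Proof.
have dl : is_derive z 1 (fun x : R => m * v + sg * x) sg.
  by apply: is_derive_eq; rewrite /GRing.scale/=; ring.
have de := @is_derive1_comp _ expR _ _ _ _ (is_derive_expR _) dl.
rewrite /comp in de; rewrite /X.
by apply: is_derive_eq; rewrite /GRing.scale/=; ring.
Qed.

Let dXv (v z : R) : is_derive v 1 (X^~ z) (m * X v z).
Proof.
have dl : is_derive v 1 (fun x : R => m * x + sg * z) m.
  by apply: is_derive_eq; rewrite /GRing.scale/=; ring.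
have de := @is_derive1_comp _ expR _ _ _ _ (is_derive_expR _) dl.
rewrite /comp in de; rewrite /X.
by apply: is_derive_eq; rewrite /GRing.scale/=; ring.
Qed.

Let lin (c v : R) : {for v, continuous (fun x : R => c * x)}.
Proof. by apply: cvgM; [exact: cvg_cst|exact: cvg_id]. Qed.

Let c2X (v z : R) : continuous2_at X v z.
Proof.
apply: (@continuous2_atM _ (fun _ _ => s0)); first exact: continuous2_at_cst.
apply: (@continuous2_at_comp _ expR (fun v z => m * v + sg * z)).
  apply: (@continuous2_atD _ (fun v _ => m * v) (fun _ z => sg * z)).
    by apply: (@continuous2_at_of_fst _ (fun x => m * x)); exact: lin.
  by apply: (@continuous2_at_of_snd _ (fun x => sg * x)); exact: lin.
exact: continuous_expR.
Qed.

Let c2_along (g : R -> R -> R -> R) (v z : R) :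
  continuous3_at g (t0 + v) (X v z) (y0 + v) -> continuous2_at (along g) v z.
Proof.
move=> cg; apply: (@continuous2_at_comp3 g (fun v _ => t0 + v) X (fun v _ => y0 + v)) => //.
  apply: (@continuous2_at_of_fst _ (fun x => t0 + x)).
  by apply: cvgD; [exact: cvg_cst|exact: cvg_id].
apply: (@continuous2_at_of_fst _ (fun x => y0 + x)).
by apply: cvgD; [exact: cvg_cst|exact: cvg_id].
Qed.

Let disc (v : R) := expR (- (r * v)).

Let c_disc : continuous disc.
Proof.
move=> v.
have c : {for v, continuous (expR \o (fun v => - (r * v)))}.
  apply: continuous_comp; last exact: continuous_expR.
  by apply: cvgN; exact: lin.
exact: c.
Qed.

Let c2_disc (v z : R) : continuous2_at (fun v _ => disc v) v z.
Proof. by apply: (@continuous2_at_of_fst _ disc); exact: c_disc. Qed.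

Let W (v z : R) := disc v * along f v z.
Let Wz (v z : R) := disc v * (along fs v z * (sg * X v z)).
Let Wzz (v z : R) := disc v * (sg ^+ 2 *
  (along fss v z * X v z ^+ 2 + along fs v z * X v z)).
Let H (v z : R) := disc v * along h v z.

Let dWz (v z : R) : - y0 < v < tau -> is_derive z 1 (W v) (Wz v z).
Proof.
move=> vt; have [_ fsP _ _] := df (dom_along z vt).
have dc := @is_derive1_comp _ (fun x => f (t0 + v) x (y0 + v)) (X v) _ _ _ fsP (dXz v z).
rewrite /comp in dc; rewrite /W /along.
by apply: is_derive_eq; rewrite /Wz /along /GRing.scale/=; ring.
Qed.

Let dWzz (v z : R) : - y0 < v < tau -> is_derive z 1 (Wz v) (Wzz v z).
Proof.
move=> vt; have [_ _ fssP _] := df (dom_along z vt).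
have dX := dXz v z.
have dc := @is_derive1_comp _ (fun x => fs (t0 + v) x (y0 + v)) (X v) _ _ _ fssP dX.
rewrite /comp in dc; rewrite /Wz /along.
by apply: is_derive_eq; rewrite /Wzz /along /GRing.scale/=; ring.
Qed.

(** The discount cancels r f. The first-order terms combine to - sg^2/2 times X f_s, which is the
    first-order part of - Wzz/2. *)
Let dWv (v z : R) : 0 < v < tau ->
  is_derive v 1 (W^~ z) (- H v z - 2^-1 * Wzz v z).
Proof.
have [/= _ _ /andP[y00 _] _] := dom0; move=> vt.
have vt' : - y0 < v < tau by lra.
have dv := dom_along z vt'.
have [d d0 dP] := dom_open dv.
have dshift (c : R) : is_derive v 1 (fun x : R => c + x) 1.
  by apply: is_derive_eq; ring.
have dff := @is_derive_comp3 _ f ft fs fy (fun x => t0 + x) (X^~ z) (fun x => y0 + x)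
  v 1 (m * X v z) 1 d d0.
have {}dff : is_derive v 1 (along f ^~ z)
    (along ft v z * 1 + along fs v z * (m * X v z) + along fy v z * 1).
  apply: dff => //.
  - by move=> t s y ht hs hy; have [? ? _ ?] := df (dP t s y ht hs hy).
  - exact: cft.
  - exact: cfs.
  - exact: cfy.
have dl : is_derive v 1 (fun x : R => - (r * x)) (- r).
  by apply: is_derive_eq; rewrite /GRing.scale/=; ring.
have de := @is_derive1_comp _ expR _ _ _ _ (is_derive_expR _) dl.
rewrite /comp -/(disc v) in de.
rewrite /W /disc; apply: is_derive_eq; rewrite -/(disc v) /GRing.scale/=.
have ftE : along ft v z = r * along f v z - along h v z - along fy v z -
    r * X v z * along fs v z - 2^-1 * sg ^+ 2 * X v z ^+ 2 * along fss v z.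
  have := pde dv; rewrite -/(along ft v z) -/(along fs v z) -/(along fss v z).
  rewrite -/(along fy v z) -/(along f v z) -/(along h v z).
  move: (along ft v z) (along fs v z) (along fss v z) (along fy v z).
  move: (along f v z) (along h v z) (X v z) => u w x a b c e E.
  have -> : a = (a + e + r * x * b + 2^-1 * sg ^+ 2 * x ^+ 2 * c) - e - r * x * b
    - 2^-1 * sg ^+ 2 * x ^+ 2 * c by ring.
  by rewrite E.
by rewrite ftE /H /Wzz /m; field.
Qed.

(** Linear growth in s becomes growth exp(sg |z|) in z, while drift and discount are bounded on the
    finite time interval; so the exponent A of the general representation is sg. *)
Let bound_along (g : R -> R -> R -> R) :
  (forall t s y : R, dom T (t, s, y) -> `|g t s y| <= C * (1 + s)) ->
  forall v z : R, 0 < v < tau ->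
    `|disc v * along g v z| <=
      expR (`|r| * tau) * C * (1 + s0 * expR (`|m| * tau)) * expR (sg * `|z|).
Proof.
move=> gC v z vt; have [/= _ s00 /andP[y00 _] _] := dom0.
have vt' : - y0 < v < tau by lra.
have gle := gC _ _ _ (dom_along z vt').
have /andP[v0 vtau] := vt.
have disc_le : disc v <= expR (`|r| * tau).
  rewrite /disc ler_expR; apply: le_trans (ler_norm _) _.
  by rewrite normrN normrM (gtr0_norm v0) ler_wpM2l// ltW.
have e1 : 1 <= expR (sg * `|z|) by rewrite -[leLHS]expR0 ler_expR mulr_ge0// ltW.
have XE : X v z <= s0 * expR (`|m| * tau) * expR (sg * `|z|).
  rewrite /X -mulrA ler_pM2l// -expRD ler_expR lerD//.
    apply: le_trans (ler_norm _) _.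
    by rewrite normrM (gtr0_norm v0) ler_wpM2l// ltW.
  by rewrite ler_pM2l// ler_norm.
have C0 : 0 <= C.
  have := le_trans (normr_ge0 _) gle; rewrite pmulr_lge0// addr_gt0//; exact: X0.
rewrite normrM (ger0_norm (expR_ge0 _)) -!mulrA.
apply: ler_pM => //.
apply: le_trans gle _; rewrite ler_wpM2l// mulrDl mul1r.
exact: lerD.
Qed.

(** Here [dl] is [y0], and the factor sg s0 is the z-derivative of the space variable at the
    origin. *)
Lemma constant_coefficients_representation :
  (forall z : R,
    f (t0 + v) (s0 * expR ((r - sg ^+ 2 / 2) * v + sg * z)) (y0 + v)
      @[v --> (T - t0)^'-] --> 0) ->
  (forall v, 0 < v < T - t0 ->
    (fun n : nat => \int[mu]_(z in `[- n.+1%:R, n.+1%:R])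
       (expR (- (r * v)) *
          h (t0 + v) (s0 * expR ((r - sg ^+ 2 / 2) * v + sg * z)) (y0 + v)
        * cutoff n.+1%:R z * dipole v z)) @ \oo --> J v) ->
  mu.-integrable `]0, T - t0[ (EFin \o J) /\
  \int[mu]_(v in `]0, T - t0[) J v = fs t0 s0 y0 * (sg * s0).
Proof.
move=> f0 HJ; have [/= /andP[_ t0T] _ /andP[y00 _] _] := dom0.
have tau0 : 0 < tau by rewrite subr_gt0.
have sub (v : R) : 0 < v < tau -> - y0 < v < tau by lra.
have c2d (g : R -> R -> R -> R) (v z : R) :
    (forall t s y : R, dom T (t, s, y) -> continuous3_at g t s y) ->
    - y0 < v < tau -> continuous2_at (along g) v z.
  by move=> cg vt; exact/c2_along/cg/dom_along.
have cW (v z : R) : - y0 < v < tau -> continuous2_at W v z.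
  by move=> vt; apply: (@continuous2_atM _ (fun v _ => disc v)) => //; exact: c2d.
have cWz (v z : R) : - y0 < v < tau -> continuous2_at Wz v z.
  move=> vt; apply: (@continuous2_atM _ (fun v _ => disc v)) => //.
  apply: continuous2_atM; first exact: c2d.
  by apply: (@continuous2_atM _ (fun _ _ => sg)) => //; exact: continuous2_at_cst.
have cWzz (v z : R) : 0 < v < tau -> continuous2_at Wzz v z.
  move=> /sub vt; apply: (@continuous2_atM _ (fun v _ => disc v)) => //.
  apply: (@continuous2_atM _ (fun _ _ => sg ^+ 2)); first exact: continuous2_at_cst.
  apply: continuous2_atD; apply: continuous2_atM => //; try exact: c2d.
  by apply: (@continuous2_at_comp _ (fun x => x ^+ 2)) => //; exact: exprn_continuous.
have cH (v z : R) : 0 < v < tau -> continuous2_at H v z.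
  by move=> /sub vt; apply: (@continuous2_atM _ (fun v _ => disc v)) => //; exact: c2d.
have dWzz' (v z : R) : 0 < v < tau -> is_derive z 1 (Wz v) (Wzz v z).
  by move=> /sub; exact: dWzz.
have W0 (z : R) : W v z @[v --> tau^'-] --> 0.
  rewrite -(mulr0 (disc tau)); apply: cvgM; last exact: f0.
  by apply: cvg_at_left_filter; exact: c_disc.
have A0 := ltW sg0.
have [iJ ->] := dipole_representation y00 tau0 A0 dWz dWzz' dWv
  cW cWz cWzz cH (bound_along f_le) (bound_along h_le) W0 HJ.
split => //.
by rewrite /Wz /along /disc /X !mulr0 !addr0 oppr0 expR0 mul1r mulr1.
Qed.

End constant_coefficients.

(** * The lognormal kernel as a dipole kernel *)

Section lognormal_kernel.
Context {R : realType}.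
Notation mu := (@lebesgue_measure R).

Lemma cutoff_cvg (z : R) :
  (fun n : nat => cutoff n.+1%:R z) @ \oo --> (1 : R).
Proof.
have Vcvg : (fun n : nat => (n.+1%:R)^-1 : R) @ \oo --> 0 by exact: cvg_harmonic.
have h : (fun n : nat => (1 - z ^+ 2 * (n.+1%:R^-1 * n.+1%:R^-1)) *
    (1 - z ^+ 2 * (n.+1%:R^-1 * n.+1%:R^-1)) : R) @ \oo -->
    (1 - z ^+ 2 * (0 * 0)) * (1 - z ^+ 2 * (0 * 0)).
  by apply: cvgM; (apply: cvgB; [exact: cvg_cst|];
    apply: cvgM; [exact: cvg_cst|exact: cvgM]).
rewrite !mulr0 subr0 mul1r in h.
suff -> : (fun n : nat => cutoff n.+1%:R z) = (fun n : nat =>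
    (1 - z ^+ 2 * (n.+1%:R^-1 * n.+1%:R^-1)) *
    (1 - z ^+ 2 * (n.+1%:R^-1 * n.+1%:R^-1))) by [].
by apply/funext => n; rewrite /cutoff expr2 -invfM -expr2.
Qed.

(** At fixed v the weight is removed by dominated convergence: it lies in [0, 1] on its segment and
    tends to 1, and [dipole_bound] with b = v supplies the integrable majorant. *)
Lemma dipole_pairing_cvg (u : R -> R) (v A M : R) :
  0 < v -> 0 <= A -> continuous u ->
  (forall z, `|u z| <= M * expR (A * `|z|)) ->
  mu.-integrable [set: R] (EFin \o (fun z => u z * dipole v z)) /\
  (fun n : nat => \int[mu]_(z in `[- n.+1%:R, n.+1%:R])
     (u z * cutoff n.+1%:R z * dipole v z)) @ \oo -->
  \int[mu]_z (u z * dipole v z).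
Proof.
move=> v0 A0 cu uM.
have M0 : 0 <= M.
  by have := le_trans (normr_ge0 _) (uM 0); rewrite pmulr_lge0// expR_gt0.
have [K K0 hK] := dipole_bound A0 v0.
have vv : 0 < v <= v by rewrite v0 lexx.
pose w n z := u z * cutoff n.+1%:R z * dipole v z.
pose E n : set R := `[- n.+1%:R, n.+1%:R]%classic.
pose g z := M * (K * (Num.sqrt v)^-1) * heat (2 * v) z.
have v20 : 0 < 2 * v by rewrite mulr_gt0.
have ig : mu.-integrable [set: R] (EFin \o g).
  exact: (integrableZl _ (M * (K * (Num.sqrt v)^-1)) (integrable_heat v20)).
have d_le z : `|u z| * `|dipole v z| <= g z.
  apply: le_trans (ler_wpM2r (normr_ge0 _) (uM z)) _.
  have -> : g z = M * (K * (Num.sqrt v)^-1 * heat (2 * v) z).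
    by rewrite /g; ring.
  rewrite -[leLHS]mulrA ler_wpM2l//; apply: le_trans (hK v z vv).
  have y0 : 0 <= z ^+ 2 / v by rewrite divr_ge0 ?sqr_ge0// ltW.
  rewrite ler_wpM2l ?expR_ge0// -[leLHS]mulr1 ler_wpM2l// lerDl.
  exact: y0.
have mw n : measurable_fun [set: R] (w n \_ (E n)).
  have : mu.-integrable (E n) (EFin \o w n).
    apply: itv_continuous_integrable => z _.
    apply: cvgM; last exact/continuous2_at_snd/continuous2_dipole.
    by apply: cvgM; [exact: cu|exact: continuous_cutoff].
  move=> /integrableP[/measurable_EFinP mg _].
  have mE : measurable (E n) by exact: measurable_itv.
  by apply/(measurable_restrict _ mE) => //; rewrite setTI.
have wcvg z : [set: R] z -> (w n \_ (E n)) z @[n --> \oo] --> u z * dipole v z.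
  move=> _.
  have h : w n z @[n --> \oo] --> u z * 1 * dipole v z.
    apply: cvgM; last exact: cvg_cst.
    by apply: cvgM; [exact: cvg_cst|exact: cutoff_cvg].
  rewrite mulr1 in h; apply: cvg_trans h; apply: near_eq_cvg.
  near=> n; rewrite patchT// inE /E/= in_itv/= -ler_norml.
  apply: le_trans (ltW (archi_boundP (normr_ge0 z))) _.
  by rewrite ler_nat ltnW// ltnS; near: n; exact: nbhs_infty_ge.
have wg n z : [set: R] z -> `|(w n \_ (E n)) z| <= g z.
  move=> _; rewrite /patch; case: ifPn => [|_]; last first.
    by rewrite normr0; apply: le_trans (d_le z); rewrite mulr_ge0.
  rewrite inE /E/= in_itv/= => zn.
  have /andP[X0 X1] := cutoff_le1 (ltr0Sn R n) zn.
  apply: le_trans (d_le z); rewrite /w normrM normrM ler_wpM2r//.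
  by rewrite (ger0_norm X0) ler_piMr.
have [iud cvw] := Rintegral_dominated_cvg measurableT mw wcvg ig wg.
split => //; suff -> : (fun n : nat => \int[mu]_(z in `[- n.+1%:R, n.+1%:R])
    (u z * cutoff n.+1%:R z * dipole v z)) = (fun n => \int[mu]_z (w n \_ (E n)) z).
  exact: cvw.
by apply/funext => n; rewrite -Rintegral_mkcond.
Unshelve. all: by end_near. Qed.

(** Along x = s exp((r - sigma^2/2) v + sigma z) the quantity [log_dev] is sigma z. The x in dx =
    sigma x dz cancels the x in the denominator, and [dipole] remains up to the factor 1/(sigma
    s). *)
Lemma lognormal_kernel_substitution (k : nat) (r sigma : 'I_k -> R) (i : 'I_k)
    (g : R -> R) (s v : R) :
  0 < sigma i -> 0 < s -> 0 < v ->
  (forall x, 0 < x -> {for x, continuous g}) ->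
  mu.-integrable [set: R] (EFin \o (fun z =>
    g (s * expR ((r i - sigma i ^+ 2 / 2) * v + sigma i * z)) * dipole v z)) ->
  \int[mu]_(x in `]0, +oo[)
    (g x * (expR (- 2^-1 * (log_dev r sigma i s v x * (sigma i * Num.sqrt v)^-1) ^+ 2)
            / (Num.sqrt (2 * pi) * x * s * sigma i * Num.sqrt v))
         * (log_dev r sigma i s v x / (sigma i ^+ 2 * v))) =
  (sigma i * s)^-1 * \int[mu]_z
    (g (s * expR ((r i - sigma i ^+ 2 / 2) * v + sigma i * z)) * dipole v z).
Proof.
move=> sg0 s0 v0 cg ig; set m := r i - sigma i ^+ 2 / 2.
pose c := s * expR (m * v).
have c0 : 0 < c by rewrite mulr_gt0 ?expR_gt0.
have sv0 : 0 < Num.sqrt v by rewrite sqrtr_gt0.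
have p2 : 0 < Num.sqrt (2 * pi) :> R by rewrite sqrtr_gt0 mulr_gt0// pi_gt0.
rewrite (log_substitution c0 sg0); last first.
  move=> x x0.
  have cl : {for x, continuous (log_dev r sigma i s v)}.
    apply: cvgB; last exact: cvg_cst.
    have h : {for x, continuous (@ln R \o (fun x => x / s))}.
      apply: continuous_comp; first by apply: cvgM; [exact: cvg_id|exact: cvg_cst].
      by apply: continuous_ln; rewrite divr_gt0.
    exact: h.
  apply: cvgM; last by apply: cvgM; [exact: cl|exact: cvg_cst].
  apply: cvgM; first exact: cg.
  apply: cvgM.
    have cq : {for x, continuous (fun x => log_dev r sigma i s v x * (sigma i * Num.sqrt v)^-1)}.
      by apply: cvgM; [exact: cl|exact: cvg_cst].
    have h : {for x, continuous (expR \o (fun x => - 2^-1 *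
        (log_dev r sigma i s v x * (sigma i * Num.sqrt v)^-1) ^+ 2))}.
      apply: continuous_comp; last exact: continuous_expR.
      apply: cvgM; first exact: cvg_cst.
      rewrite [X in X @ _ --> _](_ : _ = (fun x => (log_dev r sigma i s v x *
        (sigma i * Num.sqrt v)^-1) * (log_dev r sigma i s v x * (sigma i * Num.sqrt v)^-1))).
        exact: cvgM.
      by apply/funext => y; rewrite expr2.
    exact: h.
  apply: cvgV; first by rewrite gt_eqF// !mulr_gt0.
  by do 3 (apply: cvgM; last exact: cvg_cst); apply: cvgM; [exact: cvg_cst|exact: cvg_id].
rewrite -(RintegralZl _ _ ig)//; apply: eq_Rintegral => z _.
have -> : c * expR (sigma i * z) = s * expR (m * v + sigma i * z).
  by rewrite /c expRD mulrA.
set x := s * expR _.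
have x0 : 0 < x by rewrite mulr_gt0 ?expR_gt0.
have -> : log_dev r sigma i s v x = sigma i * z.
  by rewrite /log_dev -/m /x mulrAC divff ?gt_eqF// mul1r expRK addrC addKr.
have vE : v = Num.sqrt v ^+ 2 by rewrite sqr_sqrtr// ltW.
rewrite /dipole /heat.
have -> : - 2^-1 * (sigma i * z * (sigma i * Num.sqrt v)^-1) ^+ 2 = - (z ^+ 2 / (2 * v)).
  move: sv0 vE; move: (Num.sqrt v) => w w0 ->.
  by field; rewrite !gt_eqF.
rewrite (@sqrtrM _ (2 * pi) v); last by rewrite mulr_ge0// pi_ge0.
set e := expR _; set q := Num.sqrt (2 * pi) in p2 *.
clearbody e q.
move: (g x) e q p2 sv0 vE; move: (Num.sqrt v) => w u e q q0 w0 ->.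
by field; rewrite !gt_eqF.
Qed.

End lognormal_kernel.

(** * Limits at boundary points of the domain *)

Section closure.
Context {R : realType}.
Notation mu := (@lebesgue_measure R).

(** Relative continuity yields limits along any filter that eventually stays in A; this covers the
    boundary values y = 0 and t = T. *)
Lemma within_continuous_cvg (U V : topologicalType) (X : Type) (A : set U)
    (f : U -> V) (G : set_system X) (g : X -> U) (p : U) :
  Filter G -> {within A, continuous f} -> A p -> g @ G --> p ->
  (\forall x \near G, A (g x)) -> f (g x) @[x --> G] --> f p.
Proof.
move=> FG /subspace_continuousP cf Ap gp gA.
have gw : g @ G --> within A (nbhs p).
  move=> B /= wB; have := gp _ wB; rewrite /nbhs/= /fmap /nbhs/=.
  by apply: filterS2 gA => x Ax; apply.
exact: (cvg_comp g f gw (cf p Ap)).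
Qed.

Lemma continuous3_at_within (T : R) (g : R -> R -> R -> R) (t s y : R) :
  {within dom T, continuous (fun q : R * R * R => g q.1.1 q.1.2 q.2)} ->
  dom T (t, s, y) -> continuous3_at g t s y.
Proof.
move=> cg d.
apply: (within_continuous_cvg (G := nbhs (t, s, y)) (g := id) _ cg d).
  exact: cvg_id.
have [e e0 eP] := dom_open d.
apply/nbhs_ballP; exists e => //= -[[t' s'] y'] [[/= ht hs] hy].
by apply: eP; rewrite distrC.
Qed.

Lemma continuous3_at_bsm (T : R) (g : R -> R -> R) (t s y : R) :
  {within bsm_dom T, continuous (fun q : R * R => g q.1 q.2)} ->
  dom T (t, s, y) -> continuous3_at (fun t s _ => g t s) t s y.
Proof.
move=> cg d; have [/= t0T s0 _ _] := d.
apply: (within_continuous_cvg (G := nbhs (t, s, y)) (g := fst) _ cg) => //.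
  exact: cvg_fst.
have [e e0 eP] := dom_open d.
apply/nbhs_ballP; exists e => //= -[[t' s'] y'] [[/= ht hs] hy].
by have [|||/= ? ? _ _] := eP t' s' y'; rewrite 1?distrC.
Qed.

Lemma continuous3_atB (g h : R -> R -> R -> R) (t s y : R) :
  continuous3_at g t s y -> continuous3_at h t s y ->
  continuous3_at (fun t s y => g t s y - h t s y) t s y.
Proof. by move=> cg ch; exact: (cvgB cg ch). Qed.

Lemma continuous3_atM (g h : R -> R -> R -> R) (t s y : R) :
  continuous3_at g t s y -> continuous3_at h t s y ->
  continuous3_at (fun t s y => g t s y * h t s y) t s y.
Proof. by move=> cg ch; exact: (cvgM cg ch). Qed.

Lemma continuous3_at_of_last (g : R -> R) (t s y : R) :
  {for y, continuous g} -> continuous3_at (fun _ _ y => g y) t s y.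
Proof. by move=> cg; apply: (cvg_comp snd g) cg; exact: cvg_snd. Qed.

Lemma growth_bound (T M : R) (g : R -> R -> R -> R) (t s y : R) :
  dom T (t, s, y) -> `|g t s y / (1 + s)| <= M -> `|g t s y| <= M * (1 + s).
Proof.
move=> [/= _ s0 _ _]; have s1 : 0 < 1 + s by rewrite addr_gt0.
by rewrite normrM normfV (gtr0_norm s1) ler_pdivrMr.
Qed.

Lemma Rintegral_sum (D : set R) (I : Type) (l : seq I) (P : pred I)
    (g : I -> R -> R) : measurable D ->
  (forall i, mu.-integrable D (EFin \o g i)) ->
  \int[mu]_(x in D) (\sum_(i <- l | P i) g i x) =
  \sum_(i <- l | P i) \int[mu]_(x in D) g i x.
Proof.
move=> mD ig.
rewrite /Rintegral; under eq_integral do rewrite -sumEFin.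
rewrite (@integral_sum _ _ _ mu D mD I (fun i x => (g i x)%:E) ig) -sum_fine// => i _.
exact: (@integrable_fin_num _ _ _ mu D mD _ (ig i)).
Qed.

End closure.

(** * The price *)

Section price_derivative.
Context {R : realType} (T K : R) (k : nat).
Context (r sigma : 'I_k -> R) (lam : 'I_k -> 'I_k -> R -> R).
Context (eta : 'I_k -> R -> R -> R) (phi : R -> R -> 'I_k -> R -> R).
Notation mu := (@lebesgue_measure R).
Hypothesis sigma_gt0 : forall i, 0 < sigma i.
Hypothesis lam_gt0 : forall (i j : 'I_k) (y : R), i != j -> 0 <= y -> 0 < lam i j y.
Hypothesis lam_diff : forall i j : 'I_k, i != j -> differentiable_on_nonneg (lam i j).
Hypothesis eta_sol : forall i, bsm_solution T K (r i) (sigma i) (eta i).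
Hypothesis phi_sol : price_solution T K r sigma lam phi.

Let dom_bsm (t s y : R) : dom T (t, s, y) -> bsm_dom T (t, s).
Proof. by case. Qed.

Let dom_cldom : dom T `<=` cldom T.
Proof. by move=> [[t s] y] [/= ? ? ? ?]; split => //=; lra. Qed.

Let bsm_dom_cldom : bsm_dom T `<=` bsm_cldom T.
Proof. by move=> [t s] [/= ? ?]; split => //=; lra. Qed.

Let phi_cont (j : 'I_k) :
  {within cldom T, continuous (fun q : R * R * R => phi q.1.1 q.1.2 j q.2)}.
Proof. by case: phi_sol => + _ _ _ _ _; apply. Qed.

Let phi_within (X : Type) (G : set_system X) (a b c : X -> R) (t s y : R) (j : 'I_k) :
  Filter G -> cldom T (t, s, y) ->
  a x @[x --> G] --> t -> b x @[x --> G] --> s -> c x @[x --> G] --> y ->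
  (\forall x \near G, cldom T (a x, b x, c x)) ->
  phi (a x) (b x) j (c x) @[x --> G] --> phi t s j y.
Proof.
move=> FG d ca cb cc nd.
have := within_continuous_cvg (g := fun x => (a x, b x, c x)) FG
  (@phi_cont j) d; apply => //.
apply: (@cvg_pair _ _ _ _ (nbhs (t, s)) (nbhs y)) => //.
exact: (@cvg_pair _ _ _ _ (nbhs t) (nbhs s)).
Qed.

Let phi_growth : exists2 M, 0 <= M & forall (t s : R) (j : 'I_k) (y : R),
  dom T (t, s, y) -> `|phi t s j y| <= M * (1 + s).
Proof.
have [M MP] := price_growth phi_sol; exists `|M| => // t s j y d.
apply: (@growth_bound _ T _ (fun t s y => phi t s j y)) => //.
apply: le_trans (ler_norm M); apply: MP.
by exists t, s, j, y.
Qed.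

(** The growth bound is given on D, where y > 0; at y = 0, where the jump terms are evaluated, it
    follows by continuity from the right. *)
Let phi_growth0 (M : R) :
  (forall (t s : R) (j : 'I_k) (y : R),
    dom T (t, s, y) -> `|phi t s j y| <= M * (1 + s)) ->
  forall (t s : R) (j : 'I_k), 0 < t < T -> 0 < s -> `|phi t s j 0| <= M * (1 + s).
Proof.
move=> MP t s j t0T s0; have /andP[t0 tT] := t0T.
have d0 : cldom T (t, s, 0) by split => //=; lra.
have y0t : \forall y \near 0^'+, 0 < y < t.
  near=> y; apply/andP; split; near: y; [exact: nbhs_right_gt|exact: nbhs_right_lt].
have c : phi t s j y @[y --> 0^'+] --> phi t s j 0.
  apply: phi_within => //; [exact: cvg_cst|exact: cvg_cst|exact: cvg_at_right_filter|].
  by apply: filterS y0t => y yt; split => //=; lra.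
apply: (cvgr_to_le (cvg_norm c)).
by apply: filterS y0t => y yt; apply: MP; split => //=; lra.
Unshelve. all: by end_near. Qed.

Let eta_growth (i : 'I_k) : exists2 M, 0 <= M & forall t s y : R,
  dom T (t, s, y) -> `|eta i t s| <= M * (1 + s).
Proof.
have [M MP] := bsm_growth (eta_sol i); exists `|M| => // t s y d.
apply: (@growth_bound _ T _ (fun t s y => eta i t s) _ _ y) => //.
apply: le_trans (ler_norm M); apply: MP.
by exists (t, s) => //; exact: dom_bsm d.
Qed.

Let survival_le1 (i : 'I_k) (y : R) : survival lam i y <= 1.
Proof.
rewrite /survival -expR0 ler_expR oppr_le0; apply: Rintegral_ge0 => v _.
exact: normr_ge0.
Qed.

Let lamp (i j : 'I_k) (y : R) := lam i j (Num.max y 0).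

Let lamp_cont (i j : 'I_k) : i != j -> continuous (lamp i j).
Proof. by move=> ij; apply: differentiable_on_nonneg_continuous; exact: lam_diff. Qed.

(** The source H before discounting: what jumps out of i bring in, weighted by [survival]. *)
Let inflow (i : 'I_k) (t s y : R) :=
  survival lam i y * \sum_(j < k | j != i) lamp i j y * phi t s j 0.

Let inflow_le (i : 'I_k) (M : R) : 0 <= M ->
  (forall (t s : R) (j : 'I_k) (y : R),
    dom T (t, s, y) -> `|phi t s j y| <= M * (1 + s)) ->
  exists2 C, 0 <= C & forall t s y : R, dom T (t, s, y) ->
    `|inflow i t s y| <= C * (1 + s).
Proof.
move=> M0 MP.
have lampM (j : 'I_k) : exists L : R, 0 <= L /\
    (j != i -> forall y : R, 0 <= y <= T -> `|lamp i j y| <= L).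
  have [ji|] := boolP (j != i); last by exists 0.
  (* The rate is read as a function of two variables with a trivial first one, so compactness of {0}
     x [0, T] bounds it. *)
  have [|L L0 LP] := @box_bounded _ (fun _ => lamp i j) 0 0 0 T.
    move=> v z _ _; apply: continuous2_at_of_snd; apply: lamp_cont.
    by rewrite eq_sym.
  by exists L; split => // _ y y0T; apply: (LP 0) => //; rewrite lexx.
have [L LP] := choice lampM.
exists (\sum_(j < k | j != i) L j * M).
  by apply: sumr_ge0 => j _; rewrite mulr_ge0//; case: (LP j).
move=> t s y [/= t0T s0 y0T yt].
rewrite /inflow normrM (gtr0_norm (survival_gt0 _ _ _)).
apply: (@le_trans _ _ (1 * (\sum_(j < k | j != i) L j * M) * (1 + s))); last by rewrite mul1r.
rewrite -mulrA; apply: ler_pM => //; first exact/ltW/survival_gt0.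
apply: le_trans (ler_norm_sum _ _ _) _; rewrite mulr_suml; apply: ler_sum => j ji.
have [L0 Ly] := LP j.
rewrite normrM -mulrA; apply: ler_pM => //.
  by apply: Ly => //; lra.
exact: phi_growth0.
Qed.

(** * The comparison function at a fixed point of D *)

Section fixed_point.
Context (t0 s0 : R) (i : 'I_k) (y0 : R) (dom0 : dom T (t0, s0, y0)).

Let S := survival lam i.
Let tau := T - t0.
Let g1 := S (tau + y0).
Let sg := sigma i.
Let m := r i - sg ^+ 2 / 2.
Let X (v z : R) := s0 * expR (m * v + sg * z).

Let gap t s y := S y * phi t s i y - g1 * eta i t s.
Let gap_t t s y := S y * pd_t phi t s i y - g1 * derive1 (fun x => eta i x s) t.
Let gap_s t s y := S y * pd_s phi t s i y - g1 * derive1 (eta i t) s.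
Let gap_ss t s y := S y * pd_ss phi t s i y - g1 * derive1n 2 (eta i t) s.
Let gap_y t s y := S y * pd_y phi t s i y - (total_rate lam i y * S y) * phi t s i y.

Let derivs (t s y : R) : dom T (t, s, y) ->
  [/\ is_derive t 1 (fun x => gap x s y) (gap_t t s y),
      is_derive s 1 (fun x => gap t x y) (gap_s t s y),
      is_derive s 1 (fun x => gap_s t x y) (gap_ss t s y) &
      is_derive y 1 (gap t s) (gap_y t s y)].
Proof.
move=> d; have db := dom_bsm d; have C1 := price_C121 phi_sol.
have [_ _ /andP[/= yp _] _] := d.
have D1 (g : R -> R) (x : R) : derivable g x 1 -> is_derive x 1 g (derive1 g x).
  by move=> dg; apply: DeriveDef => //; rewrite derive1E.
have p1 := D1 _ _ (@C121_derivable_t _ _ _ _ C1 t s i y d).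
have p2 := D1 _ _ (@C121_derivable_s _ _ _ _ C1 t s i y d).
have p3 := D1 _ _ (@C121_derivable_ss _ _ _ _ C1 t s i y d).
have p4 := D1 _ _ (@C121_derivable_y _ _ _ _ C1 t s i y d).
have e1 := D1 _ _ (bsm_derivable_t (eta_sol i) db).
have e2 := D1 _ _ (bsm_derivable_s (eta_sol i) db).
have e3 := D1 _ _ (bsm_derivable_ss (eta_sol i) db).
have dS := is_derive_survival lam_gt0 lam_diff i yp.
have lin (a b du dw x : R) (u w : R -> R) : is_derive x 1 u du ->
    is_derive x 1 w dw ->
    is_derive x 1 (fun x => a * u x - b * w x) (a * du - b * dw).
  by move=> ? ?; apply: is_derive_eq; rewrite /GRing.scale/=; ring.
split.
- exact: lin p1 e1.
- exact: lin p2 e2.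
- exact: lin p3 e3.
- by apply: is_derive_eq; rewrite /gap_y /pd_y /S /GRing.scale/=; ring.
Qed.

Let c3S (t s y : R) : dom T (t, s, y) -> continuous3_at (fun _ _ y => S y) t s y.
Proof.
move=> [_ _ /andP[/= yp _] _]; apply: continuous3_at_of_last.
exact: continuous_survival lam_gt0 lam_diff i _ yp.
Qed.

Let c3f_of (a b : R -> R -> R -> R) (t s y : R) : dom T (t, s, y) ->
  {within dom T, continuous (fun q : R * R * R => a q.1.1 q.1.2 q.2)} ->
  continuous3_at b t s y ->
  continuous3_at (fun t s y => S y * a t s y - g1 * b t s y) t s y.
Proof.
move=> d ca cb; apply: continuous3_atB; apply: continuous3_atM => //.
- exact: c3S.
- exact: continuous3_at_within ca d.
- exact: cvg_cst.
Qed.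

Let c3phi (t s y : R) : dom T (t, s, y) ->
  continuous3_at (fun t s y => phi t s i y) t s y.
Proof.
move=> d; apply: (continuous3_at_within (T := T)) d.
exact: continuous_subspaceW dom_cldom (@phi_cont i).
Qed.

Let c3f (t s y : R) : dom T (t, s, y) -> continuous3_at gap t s y.
Proof.
move=> d; apply: c3f_of => //.
  exact: continuous_subspaceW dom_cldom (@phi_cont i).
apply: continuous3_at_bsm d.
exact: continuous_subspaceW bsm_dom_cldom (bsm_cont (eta_sol i)).
Qed.

Let c3ft (t s y : R) : dom T (t, s, y) -> continuous3_at gap_t t s y.
Proof.
move=> d; apply: c3f_of => //; first exact: (C121_cont_t (price_C121 phi_sol)).
exact: (continuous3_at_bsm (g := fun t s => derive1 (fun x => eta i x s) t)
  (bsm_cont_t (eta_sol i)) d).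
Qed.

Let c3fs (t s y : R) : dom T (t, s, y) -> continuous3_at gap_s t s y.
Proof.
move=> d; apply: c3f_of => //; first exact: (C121_cont_s (price_C121 phi_sol)).
exact: (continuous3_at_bsm (g := fun t s => derive1 (eta i t) s)
  (bsm_cont_s (eta_sol i)) d).
Qed.

Let c3fss (t s y : R) : dom T (t, s, y) -> continuous3_at gap_ss t s y.
Proof.
move=> d; apply: c3f_of => //; first exact: (C121_cont_ss (price_C121 phi_sol)).
exact: (continuous3_at_bsm (g := fun t s => derive1n 2 (eta i t) s)
  (bsm_cont_ss (eta_sol i)) d).
Qed.

Let c3fy (t s y : R) : dom T (t, s, y) -> continuous3_at gap_y t s y.
Proof.
move=> d; apply: continuous3_atB.
  apply: continuous3_atM; first exact: c3S.
  apply: (continuous3_at_within _ d).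
  exact: (C121_cont_y (price_C121 phi_sol)).
apply: continuous3_atM; last exact: c3phi.
apply: (@continuous3_atM _ (fun _ _ y => total_rate lam i y)); last exact: c3S.
by apply: continuous3_at_of_last; exact: continuous_total_rate.
Qed.

(** Age 0 lies on the boundary of D, so this rests on continuity up to the closure, along points
    that keep y = 0. *)
Let c3phi0 (j : 'I_k) (t s y : R) : dom T (t, s, y) ->
  continuous3_at (fun t s _ => phi t s j 0) t s y.
Proof.
move=> d; have [/= ? ? ? ?] := d.
have [e e0 eP] := dom_open d.
apply: (@phi_within _ (nbhs (t, s, y)) (fun q => q.1.1) (fun q => q.1.2)
  (fun=> 0) t s 0 j).
- by split => //=; lra.
- exact: (cvg_comp fst fst cvg_fst cvg_fst).
- exact: (cvg_comp fst snd cvg_fst cvg_snd).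
- exact: cvg_cst.
- apply/nbhs_ballP; exists e => //= -[[t' s'] y'] [[/= ht hs] hy].
  by have [|||/= ? ? ? ?] := eP t' s' y'; rewrite 1?distrC//; split => //=; lra.
Qed.

Let c3h (t s y : R) : dom T (t, s, y) -> continuous3_at (inflow i) t s y.
Proof.
move=> d; apply: continuous3_atM; first exact: c3S.
apply: cvg_big => [|j ji]; first exact: add_continuous.
apply: (@continuous3_atM _ (fun _ _ y => lamp i j y) (fun t s _ => phi t s j 0)).
  by apply: continuous3_at_of_last; apply: lamp_cont; rewrite eq_sym.
exact: c3phi0.
Qed.

(** This is [S] times the equation of phi minus [g1] times that of eta. The loss part of the jump
    sum is exactly what the derivative of [S] contributes to [gap_y]. *)
Let pde (t s y : R) : dom T (t, s, y) ->
  gap_t t s y + gap_y t s y + r i * s * gap_s t s y + 2^-1 * sg ^+ 2 * s ^+ 2 * gap_ss t s y =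
  r i * gap t s y - inflow i t s y.
Proof.
move=> d; have db := dom_bsm d.
have P1 := price_pde phi_sol i d; have P2 := bsm_pde (eta_sol i) db.
have [/= _ _ /andP[yp _] _] := d; have yp0 := ltW yp.
have sumE : \sum_(j < k | j != i) lam i j y * (phi t s j 0 - phi t s i y) =
    \sum_(j < k | j != i) lamp i j y * phi t s j 0 - total_rate lam i y * phi t s i y.
  rewrite /total_rate mulr_suml -sumrB; apply: eq_bigr => j _.
  by rewrite /lamp max_l// mulrBr.
rewrite sumE in P1.
rewrite /gap_t /gap_y /gap_s /gap_ss /gap /inflow -/S /sg.
move: P1 P2.
move: (pd_t phi t s i y) (pd_y phi t s i y) (pd_s phi t s i y) (pd_ss phi t s i y).
move: (derive1 (fun x => eta i x s) t) (derive1 (eta i t) s) (derive1n 2 (eta i t) s).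
move: (\sum_(j < k | j != i) _) (total_rate lam i y) (S y) (phi t s i y) (eta i t s).
move=> s1 q Sy u e e1 e2 e3 p1 p2 p3 p4 P1 P2.
transitivity (Sy * (p1 + p2 + r i * s * p3 + 2^-1 * sigma i ^+ 2 * s ^+ 2 * p4 +
    (s1 - q * u)) - Sy * s1 - g1 * (e1 + r i * s * e2 +
    2^-1 * sigma i ^+ 2 * s ^+ 2 * e3)); first by ring.
by rewrite P1 P2; ring.
Qed.

Let f_le : exists2 C, 0 <= C & forall t s y : R, dom T (t, s, y) ->
  `|gap t s y| <= C * (1 + s) /\ `|inflow i t s y| <= C * (1 + s).
Proof.
have [M1 M10 M1P] := phi_growth; have [M2 M20 M2P] := eta_growth i.
have [M3 M30 M3P] := inflow_le i M10 M1P.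
exists (M1 + M2 + M3); first by rewrite !addr_ge0.
move=> t s y d; have [/= _ sp _ _] := d.
have s1 : 0 <= 1 + s by rewrite addr_ge0// ltW.
have a1 := M1P _ _ i _ d; have a2 := M2P _ _ _ d; have a3 := M3P _ _ _ d.
have scale (a x b : R) : 0 < a -> a <= 1 -> `|x| <= b -> `|a * x| <= b.
  move=> a0 a1' xb; rewrite normrM (gtr0_norm a0); apply: le_trans xb.
  by rewrite ler_piMl.
have b1 := scale _ _ _ (survival_gt0 lam i y) (survival_le1 i y) a1.
have b2 := scale _ _ _ (survival_gt0 lam i (tau + y0)) (survival_le1 i _) a2.
split; rewrite !mulrDl.
  apply: le_trans (ler_normB _ _) _; apply: le_trans (lerD b1 b2) _.
  by rewrite lerDl mulr_ge0.
by apply: le_trans a3 _; rewrite lerDr addr_ge0// mulr_ge0.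
Qed.

Let X_gt0 (v z : R) : 0 < X v z.
Proof. by have [_ /= sp _ _] := dom0; rewrite mulr_gt0 ?expR_gt0. Qed.

Let X_cont_z (v : R) : continuous (X v).
Proof.
move=> z; apply: cvgM; first exact: cvg_cst.
have c : {for z, continuous (expR \o (fun x => m * v + sg * x))}.
  apply: continuous_comp; last exact: continuous_expR.
  apply: cvgD; first exact: cvg_cst.
  by apply: cvgM; [exact: cvg_cst|exact: cvg_id].
exact: c.
Qed.

Let X_cont_v (z : R) : continuous (X ^~ z).
Proof.
move=> v; apply: cvgM; first exact: cvg_cst.
have c : {for v, continuous (expR \o (fun x => m * x + sg * z))}.
  apply: continuous_comp; last exact: continuous_expR.
  apply: cvgD; last exact: cvg_cst.
  by apply: cvgM; [exact: cvg_cst|exact: cvg_id].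
exact: c.
Qed.

(** At v = tau the age is y0 + tau, where [S] equals [g1], so the two payoffs cancel. Since y0 < t0
    this age is below T, and the terminal condition of phi applies. *)
Let gap_terminal (z : R) :
  gap (t0 + v) (X v z) (y0 + v) @[v --> tau^'-] --> 0.
Proof.
have [/= /andP[tp tT] sp /andP[yp yT] /andP[_ yt]] := dom0.
have taup : 0 < tau by rewrite subr_gt0.
have shift (c : R) : c + v @[v --> tau^'-] --> c + tau.
  by apply: cvg_at_left_filter; apply: cvgD; [exact: cvg_cst|exact: cvg_id].
have t0T : t0 + tau = T by rewrite /tau addrC subrK.
have shiftT : t0 + v @[v --> tau^'-] --> T by have := shift t0; rewrite t0T.
have near_dom : \forall v \near tau^'-, 0 < v < tau.
  near=> v; apply/andP; split; near: v; [exact: nbhs_left_gt|exact: nbhs_left_lt].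
have cX : X v z @[v --> tau^'-] --> X tau z.
  by apply: cvg_at_left_filter; exact: X_cont_v.
have cphi : phi (t0 + v) (X v z) i (y0 + v) @[v --> tau^'-] -->
    phi T (X tau z) i (y0 + tau).
  apply: (@phi_within _ _ (fun v => t0 + v) (X ^~ z) (fun v => y0 + v)) => //.
  - by split => //=; rewrite ?X_gt0//; lra.
  - apply: filterS near_dom => v vt.
    by split => /=; rewrite ?X_gt0//; lra.
have ceta : eta i (t0 + v) (X v z) @[v --> tau^'-] --> eta i T (X tau z).
  apply: (within_continuous_cvg (g := fun v => (t0 + v, X v z)) (p := (T, X tau z)) _
    (bsm_cont (eta_sol i))).
  - by split => /=; rewrite ?X_gt0//; lra.
  - exact: (@cvg_pair _ _ _ _ (nbhs T) (nbhs (X tau z))).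
  - apply: filterS near_dom => v vt.
    by split => /=; rewrite ?X_gt0//; lra.
have cS : S (y0 + v) @[v --> tau^'-] --> S (y0 + tau).
  apply: cvg_at_left_filter.
  have c : {for tau, continuous (S \o (fun v => y0 + v))}.
    apply: continuous_comp; first by apply: cvgD; [exact: cvg_cst|exact: cvg_id].
    by apply: continuous_survival lam_gt0 lam_diff i _ _; rewrite addr_gt0.
  exact: c.
have -> : 0 = S (y0 + tau) * phi T (X tau z) i (y0 + tau) - g1 * eta i T (X tau z).
  rewrite (price_terminal phi_sol) ?X_gt0//; last by rewrite /tau; lra.
  by rewrite (bsm_terminal (eta_sol i)) ?X_gt0// /g1 [tau + y0]addrC subrr.
apply: cvgB; first exact: (cvgM cS cphi).
by apply: cvgM; [exact: cvg_cst|exact: ceta].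
Unshelve. all: by end_near. Qed.

Let pairing (v : R) (j : 'I_k) : 0 < v < tau ->
  mu.-integrable [set: R] (EFin \o (fun z => phi (t0 + v) (X v z) j 0 * dipole v z)) /\
  (fun n : nat => \int[mu]_(z in `[- n.+1%:R, n.+1%:R])
     (phi (t0 + v) (X v z) j 0 * cutoff n.+1%:R z * dipole v z)) @ \oo -->
  \int[mu]_z (phi (t0 + v) (X v z) j 0 * dipole v z).
Proof.
move=> /andP[vp vt].
have [/= /andP[tp tT] sp _ _] := dom0.
have tvT : 0 < t0 + v < T by move: vt; rewrite /tau; lra.
have [M M0 MP] := phi_growth.
(* The constant comes from 1 + X <= (1 + s0 exp(m v)) exp(sg |z|). *)
apply: (@dipole_pairing_cvg _ _ v sg (M * (1 + s0 * expR (m * v)))) => //.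
- exact/ltW/sigma_gt0.
- move=> z; apply: phi_within => //.
  + by split => /=; rewrite ?X_gt0//; lra.
  + exact: cvg_cst.
  + exact: X_cont_z.
  + exact: cvg_cst.
  + by apply: nearW => x; split => /=; rewrite ?X_gt0//; lra.
- move=> z; apply: le_trans (phi_growth0 MP j tvT (X_gt0 v z)) _.
  rewrite -mulrA ler_wpM2l// mulrDl mul1r lerD//.
    by rewrite -[leLHS]expR0 ler_expR mulr_ge0// ltW// sigma_gt0.
  rewrite /X expRD mulrA ler_wpM2l ?mulr_ge0 ?expR_ge0// ?(ltW sp)//.
  by rewrite ler_expR ler_wpM2l ?ler_norm// ltW// sigma_gt0.
Qed.

Let inner (v : R) (j : 'I_k) := \int[mu]_(x in `]0, +oo[)
  (phi (t0 + v) x j 0 *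
    (expR (- 2^-1 * (log_dev r sigma i s0 v x * (sigma i * Num.sqrt v)^-1) ^+ 2)
     / (Num.sqrt (2 * pi) * x * s0 * sigma i * Num.sqrt v))
   * (log_dev r sigma i s0 v x / (sigma i ^+ 2 * v))).

Let innerE (v : R) (j : 'I_k) : 0 < v < tau ->
  inner v j = (sg * s0)^-1 * \int[mu]_z (phi (t0 + v) (X v z) j 0 * dipole v z).
Proof.
move=> vt; have [iu _] := pairing j vt; have /andP[vp vT] := vt.
have [/= /andP[tp tT] sp _ _] := dom0.
rewrite /inner (@lognormal_kernel_substitution _ k r sigma i
  (fun x => phi (t0 + v) x j 0))//.
move=> x x0.
apply: (@phi_within _ (nbhs x) (fun=> t0 + v) id (fun=> 0) _ _ _ j).
- by move: vT; rewrite /tau => vT; split => //=; lra.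
- exact: cvg_cst.
- exact: cvg_id.
- exact: cvg_cst.
- near=> y; move: vT; rewrite /tau => vT; split => /=; [lra| |lra].
  by near: y; exact: lt_nbhsr.
Unshelve. all: by end_near. Qed.

Let integrand (v : R) :=
  expR (- r i * v) * (Defs.f lam (y0 + v) i / (1 - F lam y0 i))
  * \sum_(j < k | j != i) (p lam i j (y0 + v) * inner v j).

(** For each j, [p_density] turns f p into S times the rate. The prefactor undoes the two
    normalisations inside psi: 1/(sigma s) from the kernel and 1/S(y0) from conditioning on the
    age. *)
Let cutoff_inflow_cvg (v : R) : 0 < v < tau ->
  (fun n : nat => \int[mu]_(z in `[- n.+1%:R, n.+1%:R])
    (expR (- (r i * v)) * inflow i (t0 + v) (X v z) (y0 + v)
      * cutoff n.+1%:R z * dipole v z)) @ \oo --> sg * s0 * S y0 * integrand v.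
Proof.
move=> vt; have /andP[vp vT] := vt.
have [/= /andP[tp tT] sp /andP[yp _] _] := dom0.
have yv0 : 0 < y0 + v by rewrite addr_gt0.
pose c j := expR (- (r i * v)) * (S (y0 + v) * lam i j (y0 + v)).
pose u j z := phi (t0 + v) (X v z) j 0.
have cu j z : {for z, continuous (u j)}.
  apply: phi_within => //.
  + by move: vT; rewrite /tau => vT; split => /=; rewrite ?X_gt0//; lra.
  + exact: cvg_cst.
  + exact: X_cont_z.
  + exact: cvg_cst.
  + apply: nearW => x; move: vT; rewrite /tau => vT.
    by split => /=; rewrite ?X_gt0//; lra.
have -> : sg * s0 * S y0 * integrand v =
    \sum_(j < k | j != i) c j * \int[mu]_z (u j z * dipole v z).
  rewrite /integrand survivalE -/S 2!mulr_sumr; apply: eq_bigr => j ji.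
  rewrite innerE// /c -(p_density lam_gt0 lam_diff ji yv0) mulNr.
  have S0 := survival_gt0 lam i y0; have sg0 := sigma_gt0 i.
  rewrite -/S in S0 *; rewrite -/sg in sg0.
  move: (S y0) (\int[mu]_z _) (Defs.f _ _ _) (p _ _ _ _) (expR _) S0 => a b d e q a0.
  by field; rewrite !gt_eqF.
have -> : (fun n : nat => \int[mu]_(z in `[- n.+1%:R, n.+1%:R])
    (expR (- (r i * v)) * inflow i (t0 + v) (X v z) (y0 + v)
      * cutoff n.+1%:R z * dipole v z)) =
    (fun n : nat => \sum_(j < k | j != i) c j *
      \int[mu]_(z in `[- n.+1%:R, n.+1%:R]) (u j z * cutoff n.+1%:R z * dipole v z)).
  apply/funext => n.
  have iu j : mu.-integrable `[- n.+1%:R, n.+1%:R]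
      (EFin \o (fun z => u j z * cutoff n.+1%:R z * dipole v z)).
    apply: itv_continuous_integrable => z _.
    apply: cvgM; last exact/continuous2_at_snd/continuous2_dipole.
    by apply: cvgM; [exact: cu|exact: continuous_cutoff].
  have ZL j : c j * \int[mu]_(z in `[- n.+1%:R, n.+1%:R])
        (u j z * cutoff n.+1%:R z * dipole v z) =
      \int[mu]_(z in `[- n.+1%:R, n.+1%:R])
        (c j * (u j z * cutoff n.+1%:R z * dipole v z)).
    by rewrite (RintegralZl _ _ (iu j)).
  under [RHS]eq_bigr => j _ do rewrite ZL.
  rewrite -(@Rintegral_sum _ _ _ _ _
    (fun j z => c j * (u j z * cutoff n.+1%:R z * dipole v z)))//; last first.
    by move=> j; exact: (integrableZl _ (c j) (iu j)).
  apply: eq_Rintegral => z _; rewrite /inflow -/S mulr_sumr mulr_sumr !mulr_suml.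
  apply: eq_bigr => j _; rewrite /c /u /lamp max_l ?ltW//; ring.
apply: cvg_big => [|j ji]; first exact: add_continuous.
by apply: cvgM; [exact: cvg_cst|exact: (pairing j vt).2].
Qed.

(** The representation identifies the integral in psi with [gap_s] divided by S(y0), that is, phi_s
    minus g1/S(y0) times eta_s; the first term of psi is exactly the missing multiple of eta_s. *)
Lemma price_derivative_representation :
  psi T r sigma lam eta phi t0 s0 i y0 = pd_s phi t0 s0 i y0.
Proof.
have [/= /andP[tp tT] sp /andP[yp yT] _] := dom0.
have [C C0 CP] := f_le.
have [iJ intJ] := constant_coefficients_representation (sigma_gt0 i) dom0 derivs
  c3f c3ft c3fs c3fss c3fy c3h pde (fun t s y d => (CP t s y d).1)
  (fun t s y d => (CP t s y d).2) gap_terminal cutoff_inflow_cvg.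
have S0 := survival_gt0 lam i y0; have sg0 := sigma_gt0 i.
pose b := sg * s0 * S y0.
have b0 : b != 0 by rewrite gt_eqF// !mulr_gt0.
have iI : mu.-integrable `]0, tau[ (EFin \o integrand).
  have -> : integrand = (fun v => b^-1 * (b * integrand v)).
    by apply/funext => v; rewrite mulKf.
  exact: (integrableZl _ b^-1 iJ).
have mI : measurable_fun (`]0, tau[ : set R) (fun v => (integrand v)%:E).
  by have /integrableP[] := iI.
(* The endpoints form a null set; at v = 0 the integrand has only a default value, as it divides by
   v and sqrt v. *)
have closedE : \int[mu]_(v in `[0, tau]) integrand v =
    \int[mu]_(v in `]0, tau[) integrand v.
  by rewrite /Rintegral (integral_itv_bndoo _ _ mI).
have psiE : psi T r sigma lam eta phi t0 s0 i y0 =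
    g1 / S y0 * derive1 (eta i t0) s0 + \int[mu]_(v in `]0, tau[) integrand v.
  have <- : (1 - F lam (T - t0 + y0) i) / (1 - F lam y0 i) = g1 / S y0.
    by rewrite !survivalE.
  by rewrite -closedE.
rewrite psiE.
move: intJ; rewrite (RintegralZl _ _ iI)// -/b => intJ.
have -> : \int[mu]_(v in `]0, tau[) integrand v = gap_s t0 s0 y0 * (sg * s0) / b.
  by rewrite -intJ mulrAC divff// mul1r.
rewrite /gap_s /b; move: S0; rewrite -/S; move: (S y0) => a a0.
by field; rewrite !gt_eqF.
Qed.

End fixed_point.
End price_derivative.

Theorem theorem5p2 (R : realType) (T K : R) (k : nat)
  (r sigma : 'I_k -> R) (lam : 'I_k -> 'I_k -> R -> R)
  (eta : 'I_k -> R -> R -> R) (phi : R -> R -> 'I_k -> R -> R)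
  (T_gt0 : 0 < T) (K_gt0 : 0 < K) (k_gt0 : (0 < k)%N)
  (r_ge0 : forall i, 0 <= r i) (sigma_gt0 : forall i, 0 < sigma i)
  (lam_gt0 : forall (i j : 'I_k) (y : R), i != j -> 0 <= y -> 0 < lam i j y)
  (lam_diff : forall (i j : 'I_k), i != j -> differentiable_on_nonneg (lam i j))
  (Lam_oo : forall i, Lam lam i y @[y --> +oo%R] --> +oo%R)
  (phat_irr : irreducible_mx (phat lam))
  (eta_sol : forall i, bsm_solution T K (r i) (sigma i) (eta i))
  (phi_sol : price_solution T K r sigma lam phi) :
  forall (t s : R) (i : 'I_k) (y : R), dom T (t, s, y) ->
    psi T r sigma lam eta phi t s i y = pd_s phi t s i y.
Proof.
move=> t s i y d.
exact: (price_derivative_representation sigma_gt0 lam_gt0 lam_diff eta_sol phi_sol i d).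
Qed.
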